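(* The following decision problem is $\Pi_2$-complete: given a simple signature, an effect theory $\mathcal{T}$ over it, and a closed simple handler of type $F\,0$ over it (i.e. a template $x:\alpha\mid z:\beta\vdash T_{\mathsf{op}}$ for each operation symbol $\mathsf{op}:\alpha\to\beta$), decide whether the handler is correct, i.e. whether the carrier $|F\emptyset|$ of the free model of $\mathcal{T}$ over the empty set, equipped with the operations $\mathsf{op}_H(a,\kappa) = [\![T_{\mathsf{op}}]\!]_{F\emptyset}(a,\kappa)$ for $a\in[\![\alpha]\!]$, $\kappa\in|F\emptyset|^{[\![\beta]\!]}$, forms a model of $\mathcal{T}$.
   Context: A simple signature is a finite set of operation symbols $\mathsf{op}:\alpha\to\beta$, where the types are built from $\alpha,\beta ::= 1 \mid \alpha\times\beta \mid \sum_{\ell\in L}\alpha_\ell$ ($L$ finite sets of labels), with no base types and no function symbols; so every type denotes a finite set $[\![\alpha]\!]$. Signature values $V$ are built from variables, $\langle\rangle$, pairs $\langle V,W\rangle$ and injections $\ell(V)$. Templates over a value context $\Gamma$ and template context $Z=z_1:\alpha_1,\dots,z_n:\alpha_n$ are $T ::= z(V)\mid \mathsf{match}\ V\ \mathsf{with}\ \langle x,y\rangle\mapsto T\mid \mathsf{match}\ V\ \mathsf{with}\ \{\ell(x_\ell)\mapsto T_\ell\}_{\ell\in L}\mid\mathsf{op}_V(x:\beta.\,T)$ with evident typing ($z(V)$ needs $z:\alpha\in Z$, $V:\alpha$; $\mathsf{op}_V(x:\beta.T)$ needs $\mathsf{op}:\alpha\to\beta$, $V:\alpha$, and $T$ well-formed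 with $x:\beta$ added). An effect theory is a finite set of equations $\Gamma\mid Z\vdash T_1=T_2$. Given a set $|\mathcal{M}|$ with maps $\mathsf{op}_{\mathcal{M}}:[\![\alpha]\!]\times|\mathcal{M}|^{[\![\beta]\!]}\to|\mathcal{M}|$, a template denotes $[\![T]\!]_{\mathcal{M}}:[\![\Gamma]\!]\times\prod_j|\mathcal{M}|^{[\![\alpha_j]\!]}\to|\mathcal{M}|$: $z_j(V)\mapsto b_j([\![V]\!](a))$, matches select the branch, $\mathsf{op}_V(x.T)\mapsto\mathsf{op}_{\mathcal{M}}([\![V]\!](a),x\mapsto[\![T]\!]_{\mathcal{M}}(\langle a,x\rangle,b))$. A model of $\mathcal{T}$ is such a structure satisfying $[\![T_1]\!]=[\![T_2]\!]$ for all equations of $\mathcal{T}$; homomorphisms preserve the operations. $F\emptyset$ denotes the free (equivalently, initial) model of $\mathcal{T}$, and $[\![T_{\mathsf{op}}]\!]_{F\emptyset}$ is evaluated using the original operations of $F\emptyset$. *)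

(* Defs.v *)
From Stdlib Require Import List Arith.
Import ListNotations.
Set Implicit Arguments.

(* 1. Types of simple signatures.  Sum types  sum_{l in L} alpha_l    *)
(*    have a finite label set L, represented by positions 0..|L|-1   *)
(*    in the list of summands.                                         *)
Inductive ty : Type :=
| One : ty
| Prod : ty -> ty -> ty
| Sum : list ty -> ty.

Definition sum_of (f : ty -> Set) : list ty -> Set :=
  fix go (l : list ty) : Set :=
    match l with [] => Empty_set | t :: l' => (f t + go l')%type end.

Fixpoint sem (t : ty) : Set :=
  match t with
  | One => unit
  | Prod a b => (sem a * sem b)%type
  | Sum ts => sum_of sem ts
  end.

(* Positions in a list (de Bruijn indices / labels / operation symbols) *)
Inductive mem {A : Type} (x : A) : list A -> Type :=
| Here : forall l, mem x (x :: l)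
| There : forall y l, mem x l -> mem x (y :: l).
Arguments Here {A x} l.
Arguments There {A x} y {l} _.

Fixpoint pos {A : Type} {x : A} {l : list A} (m : mem x l) : nat :=
  match m with Here _ => 0 | There _ m' => S (pos m') end.

(* A simple signature: the operation symbols are the positions of the
   list; the symbol at a position holding (alpha, beta) is op : alpha -> beta. *)
Definition signature := list (ty * ty).

(* Semantic environments for a value context Gamma (innermost variable first) *)
Fixpoint senv (G : list ty) : Set :=
  match G with [] => unit | t :: G' => (sem t * senv G')%type end.

Fixpoint lookup {t : ty} {G : list ty} (m : mem t G) : senv G -> sem t :=
  match m in mem _ G return senv G -> sem t with
  | Here _ => fun e => fst e
  | There _ m' => fun e => lookup m' (snd e)
  end.

(* Valuations of a template context Z = z_1:alpha_1,...,z_n:alpha_n in a carrier X: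
   an element of prod_j X^{[[alpha_j]]} *)
Fixpoint zenv (Z : list ty) (X : Type) : Type :=
  match Z with [] => unit | t :: Z' => ((sem t -> X) * zenv Z' X)%type end.

Fixpoint zlookup {X : Type} {t : ty} {Z : list ty} (m : mem t Z) : zenv Z X -> sem t -> X :=
  match m in mem _ Z return zenv Z X -> sem t -> X with
  | Here _ => fun b => fst b
  | There _ m' => fun b => zlookup m' (snd b)
  end.

Fixpoint inj {t : ty} {ts : list ty} (m : mem t ts) : sem t -> sum_of sem ts :=
  match m in mem _ ts return sem t -> sum_of sem ts with
  | Here _ => fun x => inl x
  | There _ m' => fun x => inr (inj m' x)
  end.

Inductive val (G : list ty) : ty -> Type :=
| VVar : forall t, mem t G -> val G t
| VUnit : val G One
| VPair : forall a b, val G a -> val G b -> val G (Prod a b)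
| VInj : forall ts t, mem t ts -> val G t -> val G (Sum ts).

Fixpoint evv {G : list ty} {t : ty} (v : val G t) (e : senv G) : sem t :=
  match v in val _ t return sem t with
  | @VVar _ _ m => lookup m e
  | @VUnit _ => tt
  | @VPair _ _ _ v1 v2 => (evv v1 e, evv v2 e)
  | @VInj _ _ _ m w => inj m (evv w e)
  end.

(* Templates over signature S, template context Z and value context G.
   match V with <x,y> |-> T : T lives in context G, x:a, y:b  (y innermost);
   match V with {l(x_l) |-> T_l} : one branch per summand;
   op_V(x:beta. T)  : T lives in context G, x:beta. *)
Inductive tmpl (S : signature) (Z : list ty) : list ty -> Type :=
| TVar : forall G t, mem t Z -> val G t -> tmpl S Z G
| TSplit : forall G a b, val G (Prod a b) -> tmpl S Z (b :: a :: G) -> tmpl S Z G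
| TCase : forall G ts, val G (Sum ts) -> branches S Z G ts -> tmpl S Z G
| TOp : forall G a b, mem (a, b) S -> val G a -> tmpl S Z (b :: G) -> tmpl S Z G
with branches (S : signature) (Z : list ty) : list ty -> list ty -> Type :=
| BNil : forall G, branches S Z G []
| BCons : forall G t ts, tmpl S Z (t :: G) -> branches S Z G ts -> branches S Z G (t :: ts).

Definition opsT (S : signature) (X : Type) : Type :=
  forall a b, mem (a, b) S -> sem a -> (sem b -> X) -> X.

Fixpoint evt {S Z} {X : Type} (ops : opsT S X) (bv : zenv Z X)
  {G} (T : tmpl S Z G) (e : senv G) {struct T} : X :=
  match T in tmpl _ _ G return senv G -> X with
  | @TVar _ _ _ _ m v => fun e => zlookup m bv (evv v e)
  | @TSplit _ _ _ _ _ v T' => fun e => let p := evv v e in evt ops bv T' (snd p, (fst p, e))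
  | @TCase _ _ _ _ v brs => fun e => evb ops bv brs e (evv v e)
  | @TOp _ _ _ _ _ o v T' => fun e => ops _ _ o (evv v e) (fun y => evt ops bv T' (y, e))
  end e
with evb {S Z} {X : Type} (ops : opsT S X) (bv : zenv Z X)
  {G ts} (brs : branches S Z G ts) (e : senv G) {struct brs} : sum_of sem ts -> X :=
  match brs in branches _ _ G ts return senv G -> sum_of sem ts -> X with
  | @BNil _ _ _ => fun _ s => match s with end
  | @BCons _ _ _ _ _ T brs' => fun e s =>
      match s with
      | inl x => evt ops bv T (x, e)
      | inr s' => evb ops bv brs' e s'
      end
  end e.

Record eqn (S : signature) : Type := mkEqn {
  eG : list ty;
  eZ : list ty;
  lhs : tmpl S eZ eG;
  rhs : tmpl S eZ eG }.

Definition theory (S : signature) := list (eqn S).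

Definition handler (S : signature) : Type :=
  forall a b, mem (a, b) S -> tmpl S [b] [a].

(* 3. The free model F(empty) of a theory: well-founded (finitely      *)
(*    branching) operation trees modulo the least congruence generated *)
(*    by the equations.                                                *)
Inductive tree (S : signature) : Type :=
| Node : forall a b, mem (a, b) S -> sem a -> (sem b -> tree S) -> tree S.

Definition tree_ops (S : signature) : opsT S (tree S) :=
  fun a b o x k => Node o x k.

Inductive teq (S : signature) (E : theory S) : tree S -> tree S -> Prop :=
| teq_refl : forall t, teq E t t
| teq_sym : forall t u, teq E t u -> teq E u t
| teq_trans : forall t u w, teq E t u -> teq E u w -> teq E t w
| teq_cong : forall a b (o : mem (a, b) S) (x : sem a) (k k' : sem b -> tree S),
    (forall y, teq E (k y) (k' y)) -> teq E (Node o x k) (Node o x k')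
| teq_ax : forall (q : eqn S), In q E ->
    forall (env : senv (eG q)) (bv : zenv (eZ q) (tree S)),
      teq E (evt (@tree_ops S) bv (lhs q) env) (evt (@tree_ops S) bv (rhs q) env).

Definition handler_ops (S : signature) (H : handler S) : opsT S (tree S) :=
  fun a b o x k => evt (@tree_ops S) ((k, tt) : zenv [b] (tree S)) (H a b o) ((x, tt) : senv [a]).

(* The handler is correct iff (|F empty|, op_H) satisfies every equation of E
   (equality in |F empty| is teq; all constructions respect teq). *)
Definition handler_correct (S : signature) (E : theory S) (H : handler S) : Prop :=
  forall q : eqn S, In q E ->
    forall (env : senv (eG q)) (bv : zenv (eZ q) (tree S)),
      teq E (evt (handler_ops H) bv (lhs q) env) (evt (handler_ops H) bv (rhs q) env).

Definition cpair (x y : nat) : nat := (x + y) * (x + y + 1) / 2 + y.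
Definition enc_list (l : list nat) : nat := fold_right (fun x acc => S (cpair x acc)) 0 l.
Definition node (k : nat) (args : list nat) : nat := cpair k (enc_list args).

Fixpoint enc_ty (t : ty) : nat :=
  match t with
  | One => node 0 []
  | Prod a b => node 1 [enc_ty a; enc_ty b]
  | Sum ts => node 2 (map enc_ty ts)
  end.

Definition enc_ctx (G : list ty) : nat := enc_list (map enc_ty G).

Fixpoint enc_val {G t} (v : val G t) : nat :=
  match v with
  | @VVar _ t m => node 0 [enc_ty t; pos m]
  | @VUnit _ => node 1 []
  | @VPair _ a b v1 v2 => node 2 [enc_ty a; enc_ty b; enc_val v1; enc_val v2]
  | @VInj _ ts t m w => node 3 [enc_ctx ts; enc_ty t; pos m; enc_val w]
  end.

Fixpoint enc_tmpl {S Z G} (T : tmpl S Z G) : nat :=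
  match T with
  | @TVar _ _ _ t m v => node 0 [enc_ty t; pos m; enc_val v]
  | @TSplit _ _ _ a b v T' => node 1 [enc_ty a; enc_ty b; enc_val v; enc_tmpl T']
  | @TCase _ _ _ ts v brs => node 2 [enc_ctx ts; enc_val v; enc_list (enc_brs brs)]
  | @TOp _ _ _ a b o v T' => node 3 [enc_ty a; enc_ty b; pos o; enc_val v; enc_tmpl T']
  end
with enc_brs {S Z G ts} (brs : branches S Z G ts) : list nat :=
  match brs with
  | @BNil _ _ _ => []
  | @BCons _ _ _ _ _ T brs' => enc_tmpl T :: enc_brs brs'
  end.

Definition enc_eqn {S} (q : eqn S) : nat :=
  node 0 [enc_ctx (eG q); enc_ctx (eZ q); enc_tmpl (lhs q); enc_tmpl (rhs q)].

Fixpoint enc_handler_aux (S0 : signature) (l : signature)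
  : (forall a b, mem (a, b) l -> tmpl S0 [b] [a]) -> list nat :=
  match l return (forall a b, mem (a, b) l -> tmpl S0 [b] [a]) -> list nat with
  | [] => fun _ => []
  | p :: l' => fun H =>
      enc_tmpl (H (fst p) (snd p) (match p as p0 return mem (fst p0, snd p0) (p0 :: l') with
                                   | (a, b) => Here l' end))
      :: @enc_handler_aux S0 l' (fun a b m => H a b (There p m))
  end.

Record instance : Type := mkInstance {
  i_sig : signature;
  i_thy : theory i_sig;
  i_hdl : handler i_sig }.

Definition enc_instance (I : instance) : nat :=
  node 0 [ enc_list (map (fun p => node 0 [enc_ty (fst p); enc_ty (snd p)]) (i_sig I));
           enc_list (map enc_eqn (i_thy I));
           enc_list (@enc_handler_aux (i_sig I) (i_sig I) (i_hdl I)) ].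

Definition HandlerCorrectness (n : nat) : Prop :=
  exists I : instance, enc_instance I = n /\ handler_correct (i_thy I) (i_hdl I).

Inductive rf : Type :=
| RZero : rf
| RSucc : rf
| RProj : nat -> rf
| RComp : rf -> list rf -> rf
| RPrec : rf -> rf -> rf
| RMin : rf -> rf.

Inductive reval : rf -> list nat -> nat -> Prop :=
| ev_zero : forall xs, reval RZero xs 0
| ev_succ : forall x xs, reval RSucc (x :: xs) (S x)
| ev_proj : forall i xs, i < length xs -> reval (RProj i) xs (nth i xs 0)
| ev_comp : forall f gs xs ys v,
    revals gs xs ys -> reval f ys v -> reval (RComp f gs) xs v
| ev_prec0 : forall f g xs v, reval f xs v -> reval (RPrec f g) (0 :: xs) v
| ev_precS : forall f g n xs w v,
    reval (RPrec f g) (n :: xs) w -> reval g (n :: w :: xs) v ->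
    reval (RPrec f g) (S n :: xs) v
| ev_min : forall f xs n,
    reval f (n :: xs) 0 ->
    (forall m, m < n -> exists k, reval f (m :: xs) (S k)) ->
    reval (RMin f) xs n
with revals : list rf -> list nat -> list nat -> Prop :=
| evs_nil : forall xs, revals [] xs []
| evs_cons : forall g gs xs y ys,
    reval g xs y -> revals gs xs ys -> revals (g :: gs) xs (y :: ys).

Definition computable (f : nat -> nat) : Prop :=
  exists p : rf, forall n, reval p [n] (f n).

Definition Pi2 (A : nat -> Prop) : Prop :=
  exists p : rf,
    (forall n x y, exists v, reval p [n; x; y] v) /\
    (forall n, A n <-> forall x, exists y, reval p [n; x; y] 0).

Definition Pi2_hard (A : nat -> Prop) : Prop :=
  forall B : nat -> Prop, Pi2 B ->
    exists f, computable f /\ forall n, B n <-> A (f n).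

Definition Pi2_complete (A : nat -> Prop) : Prop := Pi2 A /\ Pi2_hard A.

(* Main.v *)
(* Membership.  Derivability from a finite set of Horn clauses over codes is
   semi-decidable: a goal stack is run against an arbitrary stream of choices.  A
   single program derives "n codes an instance", "z codes an equation of n with an
   environment and a valuation in trees", and "the two sides of the equation z,
   evaluated with the handled operations, are equal in the free model".  So
   correctness is "n is an instance, and every valid z is derivably equal"; the
   certificate of the validity of z moves to the universal quantifier.

   Hardness.  The signature and the theory are fixed: the theory is a
   continuation-passing interpreter of recursive functions, with the program given
   as a term.  The operation LChk runs a program on a numeral z, and yields LTrue
   when z has any other operation below its successors.  The theory contains
   LAsk(z) = LTrue; the handler maps LAsk to LChk applied to the program and n, and
   all other 4-ary operations to LTrue, so that its correctness amounts to
   LChk(z) = LTrue for all trees z, hence to the halting of the program on every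
   numeral.  Conversely, a provable LChk(z) = LTrue implies halting because the
   theory has a model in which a configuration denotes the proposition that its
   computation halts with an accepted value. *)
Require Import Defs.
From Stdlib Require Import List Arith Lia FinFun PropExtensionality.
Import ListNotations.
Set Implicit Arguments.

(** * Recursive functions *)

(** Trees branch through functions out of finite types and no functional extensionality is used.
    Hence equal codes only give [teq], compiled templates agree with terms only up to [teq], and
    correctness is transferred along codes rather than along equal instances.

    [LAsk] lets a fixed theory speak about a varying program and input: as an axiom
    [LAsk(z) = LTrue] is harmless, and only handling turns it into a claim about them, so the
    reduction has to compute nothing but the code of a handler. No other equation has [LAsk] at a
    root, so after handling each of them reads [LTrue = LTrue].

    Continuations make every computation step an axiom applied at the root of a configuration. In
    the model both sides of each equation are then propositions, which propositional extensionality
    identifies; continuations, which are predicates, never have to be compared. Since equations can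
    also be used backwards and on ill-sorted trees, such a model is needed to recover halting from
    provable equality. *)

Fixpoint tri (n : nat) : nat := match n with 0 => 0 | S m => tri m + S m end.

(** Replaces the division in [cpair] by a primitive recursion, from which the computability of
    pairing follows. *)
Lemma cpair_tri x y : cpair x y = tri (x + y) + y.
Proof.
  unfold cpair. f_equal. generalize (x + y). intro n. clear.
  assert (H : n * (n + 1) = tri n * 2) by (induction n; simpl tri; lia).
  rewrite H. apply Nat.div_mul. lia.
Qed.

Definition ifz (c a b : nat) : nat := match c with 0 => a | S _ => b end.

(** The antidiagonal of [z] in Cantor's enumeration, that is, the largest d with [tri d <= z]. It
    grows by at most one per step, so a primitive recursion finds it. *)
Fixpoint diag (z : nat) : nat :=
  match z with
  | 0 => 0
  | S z' => ifz (tri (S (diag z')) - S z') (S (diag z')) (diag z')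
  end.

Definition upr (z : nat) : nat := z - tri (diag z).
Definition upl (z : nat) : nat := diag z - upr z.

Lemma tri_mono m n : m <= n -> tri m <= tri n.
Proof. induction 1; simpl; lia. Qed.

Lemma diag_spec z : tri (diag z) <= z < tri (S (diag z)).
Proof.
  induction z as [|z IH]; [simpl; lia|].
  cbn [diag]. destruct (tri (S (diag z)) - S z) eqn:E; cbn [ifz tri] in *; lia.
Qed.

Lemma diag_cpair x y : diag (cpair x y) = x + y.
Proof.
  pose proof (diag_spec (cpair x y)) as H. rewrite cpair_tri in *.
  set (d := diag _) in *.
  destruct (lt_eq_lt_dec d (x + y)) as [[L| ->]|L]; [|reflexivity|].
  - pose proof (@tri_mono (S d) (x + y)). lia.
  - pose proof (@tri_mono (S (x + y)) d ltac:(lia)). cbn [tri] in *. lia.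
Qed.

Lemma upr_cpair x y : upr (cpair x y) = y.
Proof. unfold upr. rewrite diag_cpair, cpair_tri. lia. Qed.

Lemma upl_cpair x y : upl (cpair x y) = x.
Proof. unfold upl. rewrite upr_cpair, diag_cpair. lia. Qed.

Lemma upr_0 : upr 0 = 0.
Proof. reflexivity. Qed.

Lemma upl_0 : upl 0 = 0.
Proof. reflexivity. Qed.

Lemma cpair_inj x y x' y' : cpair x y = cpair x' y' -> x = x' /\ y = y'.
Proof.
  intro H. split.
  - rewrite <- (upl_cpair x y), H. apply upl_cpair.
  - rewrite <- (upr_cpair x y), H. apply upr_cpair.
Qed.

Lemma enc_list_inj l l' : enc_list l = enc_list l' -> l = l'.
Proof.
  revert l'. induction l as [|x l IH]; intros [|y l'] H; try reflexivity; try discriminate.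
  injection H as H. apply cpair_inj in H as [-> H]. f_equal. now apply IH.
Qed.

Lemma node_inj k l k' l' : node k l = node k' l' -> k = k' /\ l = l'.
Proof. intro H. apply cpair_inj in H as [-> H]. split; [reflexivity|]. now apply enc_list_inj. Qed.

(** * Closure properties of total computable functions of [k] arguments *)

Definition cf (k : nat) (F : list nat -> nat) : Prop :=
  exists p, forall xs, length xs = k -> reval p xs (F xs).

Lemma cf_ext k F G : (forall xs, length xs = k -> F xs = G xs) -> cf k F -> cf k G.
Proof. intros H [p Hp]. exists p. intros xs Hx. rewrite <- H; auto. Qed.

Lemma cf_proj k i : i < k -> cf k (fun xs => nth i xs 0).
Proof. intro H. exists (RProj i). intros xs Hx. constructor. lia. Qed.

Lemma cf_comp k m G Fs :
  cf m G -> Forall (cf k) Fs -> length Fs = m -> cf k (fun xs => G (map (fun F => F xs) Fs)).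
Proof.
  intros [p Hp] HF Hm.
  assert (Hq : exists qs, forall xs, length xs = k -> revals qs xs (map (fun F => F xs) Fs)).
  { clear Hm. induction HF as [|F Fs [q Hq] _ [qs Hqs]].
    - exists []. intros. constructor.
    - exists (q :: qs). intros xs Hx. constructor; auto. }
  destruct Hq as [qs Hqs]. exists (RComp p qs). intros xs Hx.
  econstructor; [eauto|]. apply Hp. now rewrite length_map.
Qed.

Lemma cf_app1 k f F : cf 1 (fun xs => f (nth 0 xs 0)) -> cf k F -> cf k (fun xs => f (F xs)).
Proof. intros Hf HF. now apply (cf_comp (Fs := [F]) Hf); [repeat constructor|]. Qed.

Lemma cf_app2 k f F G :
  cf 2 (fun xs => f (nth 0 xs 0) (nth 1 xs 0)) ->
  cf k F -> cf k G -> cf k (fun xs => f (F xs) (G xs)).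
Proof. intros Hf HF HG. now apply (cf_comp (Fs := [F; G]) Hf); [repeat constructor|]. Qed.

Lemma cf_app3 k f F G H :
  cf 3 (fun xs => f (nth 0 xs 0) (nth 1 xs 0) (nth 2 xs 0)) ->
  cf k F -> cf k G -> cf k H -> cf k (fun xs => f (F xs) (G xs) (H xs)).
Proof. intros Hf HF HG HH. now apply (cf_comp (Fs := [F; G; H]) Hf); [repeat constructor|]. Qed.

Lemma cf_prec k F G :
  cf k F -> cf (S (S k)) G ->
  cf (S k) (fun xs => nat_rect (fun _ => nat) (F (tl xs)) (fun n w => G (n :: w :: tl xs)) (hd 0 xs)).
Proof.
  intros [p Hp] [q Hq]. exists (RPrec p q).
  intros [|n xs] Hx; [discriminate|]. injection Hx as Hx. cbn [hd tl].
  induction n as [|n IH]; cbn [nat_rect].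
  - constructor. auto.
  - econstructor; [exact IH|]. apply Hq. simpl. congruence.
Qed.

Lemma cf_succ k F : cf k F -> cf k (fun xs => S (F xs)).
Proof.
  apply (@cf_app1 k S F). exists RSucc. intros [|x [|]] Hx; try discriminate. constructor.
Qed.

Lemma cf_const k c : cf k (fun _ => c).
Proof.
  induction c as [|c IH].
  - exists RZero. constructor.
  - now apply cf_succ.
Qed.

Lemma cf_add k F G : cf k F -> cf k G -> cf k (fun xs => F xs + G xs).
Proof.
  apply (@cf_app2 k plus F G).
  eapply cf_ext; [|exact (cf_prec (cf_proj (k := 1) (i := 0) ltac:(lia))
                             (cf_succ (cf_proj (k := 3) (i := 1) ltac:(lia))))].
  intros [|x [|y [|]]] Hx; try discriminate. clear Hx; simpl. induction x; simpl; auto.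
Qed.

Lemma cf_pred k F : cf k F -> cf k (fun xs => pred (F xs)).
Proof.
  apply (@cf_app1 k pred F).
  eapply cf_ext; [|exact (cf_prec (cf_const 0 0) (cf_proj (k := 2) (i := 0) ltac:(lia)))].
  intros [|[|x] [|]] Hx; try discriminate; reflexivity.
Qed.

Lemma cf_sub k F G : cf k F -> cf k G -> cf k (fun xs => F xs - G xs).
Proof.
  (* [RPrec] recurses on its first argument, whereas subtraction iterates [pred] along the second;
     hence the swap. *)
  intros HF HG. refine (@cf_app2 k (fun y x => x - y) G F _ HG HF).
  eapply cf_ext; [|exact (cf_prec (cf_proj (k := 1) (i := 0) ltac:(lia))
                             (cf_pred (cf_proj (k := 3) (i := 1) ltac:(lia))))].
  intros [|x [|y [|]]] Hx; try discriminate.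
  cbn [hd tl nth]. clear Hx; induction x as [|x IH]; [cbn; lia|]. cbn [nat_rect nth]. rewrite IH. lia.
Qed.

Lemma cf_ifz k F G H : cf k F -> cf k G -> cf k H -> cf k (fun xs => ifz (F xs) (G xs) (H xs)).
Proof.
  apply (@cf_app3 k ifz F G H).
  eapply cf_ext; [|exact (cf_prec (cf_proj (k := 2) (i := 0) ltac:(lia))
                             (cf_proj (k := 4) (i := 3) ltac:(lia)))].
  intros [|[|x] [|y [|z [|]]]] Hx; try discriminate; reflexivity.
Qed.

Lemma cf_tri k F : cf k F -> cf k (fun xs => tri (F xs)).
Proof.
  apply (@cf_app1 k tri F).
  eapply cf_ext; [|exact (cf_prec (cf_const 0 0)
     (cf_add (cf_proj (k := 2) (i := 1) ltac:(lia))
             (cf_succ (cf_proj (k := 2) (i := 0) ltac:(lia)))))].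
  intros [|x [|]] Hx; try discriminate. clear Hx; simpl. induction x; simpl; congruence.
Qed.

Lemma cf_diag k F : cf k F -> cf k (fun xs => diag (F xs)).
Proof.
  apply (@cf_app1 k diag F).
  pose proof (cf_proj (k := 2) (i := 0) ltac:(lia)) as P0.
  pose proof (cf_proj (k := 2) (i := 1) ltac:(lia)) as P1.
  eapply cf_ext; [|exact (cf_prec (cf_const 0 0)
     (cf_ifz (cf_sub (cf_tri (cf_succ P1)) (cf_succ P0)) (cf_succ P1) P1))].
  intros [|x [|]] Hx; try discriminate. cbn [hd tl nth].
  clear Hx; induction x as [|x IH]; [reflexivity|]. cbn [nat_rect nth diag]. now rewrite IH.
Qed.

Lemma cf_cpair k F G : cf k F -> cf k G -> cf k (fun xs => cpair (F xs) (G xs)).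
Proof.
  intros HF HG. eapply cf_ext; [intros; symmetry; apply cpair_tri|].
  apply cf_add; [apply cf_tri, cf_add|]; assumption.
Qed.

Lemma cf_upr k F : cf k F -> cf k (fun xs => upr (F xs)).
Proof. intro HF. apply cf_sub; [|apply cf_tri, cf_diag]; assumption. Qed.

Lemma cf_upl k F : cf k F -> cf k (fun xs => upl (F xs)).
Proof. intro HF. apply cf_sub; [apply cf_diag|apply cf_upr]; assumption. Qed.

Lemma cf_iter k s F G :
  cf 1 (fun xs => s (nth 0 xs 0)) -> cf k F -> cf k G ->
  cf k (fun xs => Nat.iter (F xs) s (G xs)).
Proof.
  intro Hs. apply (@cf_app2 k (fun n x => Nat.iter n s x) F G).
  eapply cf_ext; [|exact (cf_prec (cf_proj (k := 1) (i := 0) ltac:(lia))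
                             (cf_app1 s Hs (cf_proj (k := 3) (i := 1) ltac:(lia))))].
  intros [|x [|y [|]]] Hx; try discriminate. clear Hx; simpl. induction x; simpl; congruence.
Qed.

Global Opaque cpair upl upr.

Fixpoint rf_nested_ind (Q : rf -> Prop)
  (hzero : Q RZero) (hsucc : Q RSucc) (hproj : forall i, Q (RProj i))
  (hcomp : forall f gs, Q f -> Forall Q gs -> Q (RComp f gs))
  (hprec : forall f g, Q f -> Q g -> Q (RPrec f g))
  (hmin : forall f, Q f -> Q (RMin f)) (f : rf) : Q f :=
  let rec := rf_nested_ind hzero hsucc hproj hcomp hprec hmin in
  match f with
  | RZero => hzero
  | RSucc => hsucc
  | RProj i => hproj i
  | RComp f gs => hcomp f gs (rec f)
      ((fix go l : Forall Q l :=
          match l with [] => Forall_nil Q | g :: l' => Forall_cons g (rec g) (go l') end) gs)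
  | RPrec f g => hprec f g (rec f) (rec g)
  | RMin f => hmin f (rec f)
  end.

(** The induction is on the program: the premises of [ev_min] hide derivations under an existential.
    Of two distinct minima, the smaller would be sent by [f] both to zero and to a successor. *)
Lemma reval_det f xs v w : reval f xs v -> reval f xs w -> v = w.
Proof.
  revert xs v w. induction f as [| |i|f gs IHf IHgs|f g IHf IHg|f IHf] using rf_nested_ind;
    intros xs v w Hv Hw.
  1-3: inversion Hv; inversion Hw; congruence.
  - inversion Hv as [| | |? ? ? ys ? Hys Hfv| | |]; subst.
    inversion Hw as [| | |? ? ? zs ? Hzs Hfw| | |]; subst.
    assert (ys = zs); [|subst; eauto]. clear - IHgs Hys Hzs.
    revert ys zs Hys Hzs. induction IHgs as [|g gs IHg _ IH]; intros ys zs Hys Hzs;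
      inversion Hys; inversion Hzs; subst; [reflexivity|]. f_equal; eauto.
  - destruct xs as [|n xs]; [inversion Hv|]. revert v w Hv Hw.
    induction n as [|n IH]; intros v w Hv Hw; inversion Hv; inversion Hw; subst; [eauto|].
    assert (w0 = w1) by eauto. subst. eauto.
  - inversion Hv as [| | | | | |? ? ? H1 H2]; subst.
    inversion Hw as [| | | | | |? ? ? H3 H4]; subst.
    destruct (lt_eq_lt_dec v w) as [[L| ->]|L]; [|reflexivity|].
    + destruct (H4 _ L) as [k Hk]. discriminate (IHf _ _ _ H1 Hk).
    + destruct (H2 _ L) as [k Hk]. discriminate (IHf _ _ _ H3 Hk).
Qed.

(** * Horn clauses *)

Inductive hterm : Type :=
| HV : nat -> hterm
| HC : nat -> hterm
| HS : hterm -> hterm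
| HP : hterm -> hterm -> hterm.

(** One number codes an assignment of all variables: it is read as a stream with head [upl] and tail
    [upr]. *)
Definition var (i e : nat) : nat := upl (Nat.iter i upr e).

Fixpoint heval (e : nat) (t : hterm) : nat :=
  match t with
  | HV i => var i e
  | HC c => c
  | HS t => S (heval e t)
  | HP t u => cpair (heval e t) (heval e u)
  end.

Definition atom : Type := nat * list hterm.
Definition clause : Type := atom * list atom.
Definition hfact : Type := nat * list nat.
Definition inst (e : nat) (a : atom) : hfact := (fst a, map (heval e) (snd a)).
Definition efact (f : hfact) : nat := node (fst f) (snd f).

Inductive der (P : list clause) : hfact -> Prop :=
| der_intro : forall c e, In c P -> (forall b, In b (snd c) -> der P (inst e b)) ->
    der P (inst e (fst c)).

Definition stack (l : list hfact) : nat := enc_list (map efact l).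

Definition dist (a b : nat) : nat := (a - b) + (b - a).

Definition push (fs : list hfact) (rest : nat) : nat :=
  fold_right (fun f acc => S (cpair (efact f) acc)) rest fs.

(** The program [P] is fixed, so this recursion takes place outside the computed function and leaves
    a finite cascade of tests. Comparing pairs checks the clause index and the head in a single zero
    test. *)
Fixpoint select (P : list clause) (i a g rest old : nat) : nat :=
  match P with
  | [] => old
  | c :: P' =>
      ifz (dist (cpair i (efact (inst (upr a) (fst c)))) (cpair (upl a) g))
        (push (map (inst (upr a)) (snd c)) rest)
        (select P' (S i) a g rest old)
  end.

(* A state is a stack of goals paired with a stream of choices; a choice selects
   a clause and an assignment of its variables, and is ignored if the head does
   not match the top goal. *)
Definition step (P : list clause) (st : nat) : nat :=
  ifz (upl st) st
    (cpair (select P 0 (upl (upr st)) (upl (pred (upl st))) (upr (pred (upl st))) (upl st))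
       (upr (upr st))).

(** The certificate [y] packs a number of steps with a stream of choices. The value is the code of
    the remaining goals, zero exactly when none is left. *)
Definition check (P : list clause) (goal y : nat) : nat :=
  upl (Nat.iter (upl y) (step P) (cpair (S (cpair goal 0)) (upr y))).

Lemma efact_inj f g : efact f = efact g -> f = g.
Proof. destruct f, g. intro H. apply node_inj in H as [H1 H2]. cbn in *. now subst. Qed.

Lemma push_stack fs l : push fs (stack l) = stack (fs ++ l).
Proof. unfold push, stack. induction fs as [|f fs IH]; cbn in *; [reflexivity|now rewrite IH]. Qed.

Lemma dist_eq a : dist a a = 0.
Proof. unfold dist. lia. Qed.

Lemma dist_0 a b : dist a b = 0 -> a = b.
Proof. unfold dist. lia. Qed.

Lemma select_sound P i a g rest old :
  select P i a g rest old = old \/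
  exists c, In c P /\ efact (inst (upr a) (fst c)) = g /\
    select P i a g rest old = push (map (inst (upr a)) (snd c)) rest.
Proof.
  revert i. induction P as [|c P IH]; intro i; [now left|]. cbn [select].
  destruct (dist _ _) eqn:E; cbn [ifz].
  - apply dist_0, cpair_inj in E as [_ E]. right. exists c. firstorder.
  - destruct (IH (S i)) as [H|(c' & H1 & H2)]; [now left|]. right. exists c'. firstorder.
Qed.

Lemma select_complete P c n i e rest old :
  nth_error P n = Some c ->
  select P i (cpair (i + n) e) (efact (inst e (fst c))) rest old =
  push (map (inst e) (snd c)) rest.
Proof.
  revert i n. induction P as [|c' P IH]; intros i [|n] H; try discriminate; cbn [select].
  - injection H as ->. rewrite upr_cpair, upl_cpair, Nat.add_0_r, dist_eq. reflexivity.
  - destruct (dist _ _) eqn:E.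
    + apply dist_0, cpair_inj in E as [E _]. rewrite upl_cpair in E. lia.
    + cbn [ifz]. rewrite Nat.add_succ_r. apply (IH (S i)). exact H.
Qed.

Lemma iter_sound P t l cert :
  upl (Nat.iter t (step P) (cpair (stack l) cert)) = 0 -> forall f, In f l -> der P f.
Proof.
  revert l cert. induction t as [|t IH]; intros l cert.
  - cbn. rewrite upl_cpair. destruct l; [easy|discriminate].
  - rewrite Nat.iter_succ_r. destruct l as [|f l]; [easy|].
    unfold step at 2. rewrite upl_cpair, upr_cpair. cbn [ifz].
    change (pred (stack (f :: l))) with (cpair (efact f) (stack l)).
    rewrite upl_cpair, upr_cpair. cbn [stack map enc_list fold_right ifz].
    change (S (cpair (efact f) (fold_right (fun x acc => S (cpair x acc)) 0 (map efact l))))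
      with (stack (f :: l)).
    destruct (select_sound P 0 (upl cert) (efact f) (stack l) (stack (f :: l)))
      as [-> | (c & Hc & Hf & ->)].
    + apply IH.
    + rewrite push_stack. intros H g Hg. specialize (IH _ _ H). apply efact_inj in Hf.
      destruct Hg as [<-|Hg].
      * rewrite <- Hf. constructor; [assumption|]. intros b Hb. apply IH, in_or_app. left.
        now apply in_map.
      * apply IH, in_or_app. now right.
Qed.

(** The choices [cs] clear exactly the goal [f], whatever goals lie below and whatever stream
    follows. This uniformity is what allows the choices for the premises of a clause to be
    concatenated. *)
Lemma iter_complete P f :
  der P f ->
  exists cs, forall l cert,
    Nat.iter (length cs) (step P) (cpair (stack (f :: l)) (fold_right cpair cert cs)) =
    cpair (stack l) cert.
Proof.
  induction 1 as [c e Hc _ IH].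
  assert (Hb : forall bs, (forall b, In b bs -> In b (snd c)) ->
    exists cs, forall l cert,
      Nat.iter (length cs) (step P)
        (cpair (stack (map (inst e) bs ++ l)) (fold_right cpair cert cs)) =
      cpair (stack l) cert).
  { induction bs as [|b bs IHbs]; intro Hbs.
    - now exists [].
    - destruct (IH b) as [cs1 H1]; [apply Hbs; now left|].
      destruct IHbs as [cs2 H2]; [intros; apply Hbs; now right|].
      exists (cs1 ++ cs2). intros l cert.
      rewrite length_app, Nat.add_comm, Nat.iter_add, fold_right_app. cbn [map app].
      now rewrite H1, H2. }
  destruct (Hb (snd c)) as [cs Hcs]; [auto|]. clear Hb IH.
  apply In_nth_error in Hc as [n Hn].
  exists (cpair n e :: cs). intros l cert. cbn [length fold_right].
  rewrite Nat.iter_succ_r. unfold step at 2. rewrite upl_cpair, upr_cpair, upl_cpair, upr_cpair.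
  change (pred (stack (inst e (fst c) :: l))) with (cpair (efact (inst e (fst c))) (stack l)).
  rewrite upl_cpair, upr_cpair, (@select_complete P c n 0 e _ _ Hn), push_stack. apply Hcs.
Qed.

Lemma check_der P f : der P f <-> exists y, check P (efact f) y = 0.
Proof.
  unfold check. split.
  - intros H. destruct (iter_complete H) as [cs Hcs].
    exists (cpair (length cs) (fold_right cpair 0 cs)). rewrite upl_cpair, upr_cpair.
    change (S (cpair (efact f) 0)) with (stack [f]). rewrite Hcs. apply upl_cpair.
  - intros [y H]. change (S (cpair (efact f) 0)) with (stack [f]) in H.
    apply (iter_sound _ _ _ _ H). now left.
Qed.

Lemma cf_heval k t E : cf k E -> cf k (fun xs => heval (E xs) t).
Proof.
  intro HE. induction t as [i|c|t IH|t IHt u IHu]; cbn [heval].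
  - apply cf_upl. induction i; cbn; [assumption|]. now apply cf_upr.
  - apply cf_const.
  - now apply cf_succ.
  - now apply cf_cpair.
Qed.

Lemma cf_inst k a E : cf k E -> cf k (fun xs => efact (inst (E xs) a)).
Proof.
  intro HE. destruct a as [p ts]. unfold efact, node. cbn [inst fst snd].
  apply cf_cpair; [apply cf_const|].
  induction ts as [|t ts IH]; cbn; [apply cf_const|].
  apply cf_succ, cf_cpair; [now apply cf_heval|exact IH].
Qed.

Lemma cf_select k P A G R O :
  cf k A -> cf k G -> cf k R -> cf k O ->
  forall i, cf k (fun xs => select P i (A xs) (G xs) (R xs) (O xs)).
Proof.
  intros HA HG HR HO. induction P as [|c P IH]; intro i; cbn [select]; [assumption|].
  assert (HE := cf_upr HA).
  assert (H1 := cf_cpair (cf_const k i) (cf_inst (fst c) HE)).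
  assert (H2 := cf_cpair (cf_upl HA) HG).
  apply cf_ifz; [now apply cf_add; apply cf_sub| |apply IH].
  induction (snd c) as [|b bs IHb]; cbn; [assumption|].
  apply cf_succ, cf_cpair; [now apply cf_inst|exact IHb].
Qed.

Lemma cf_step P : cf 1 (fun xs => step P (nth 0 xs 0)).
Proof.
  assert (H := cf_proj (k := 1) (i := 0) ltac:(lia)).
  assert (H1 := cf_upl H). assert (H2 := cf_upr H).
  apply cf_ifz; [assumption..|]. apply cf_cpair; [|now apply cf_upr].
  assert (H3 := cf_pred H1).
  apply cf_select; [now apply cf_upl|now apply cf_upl|now apply cf_upr|assumption].
Qed.

Lemma cf_check k P G Y : cf k G -> cf k Y -> cf k (fun xs => check P (G xs) (Y xs)).
Proof.
  intros HG HY. apply cf_upl, cf_iter; [apply cf_step|now apply cf_upl|].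
  apply cf_cpair; [|now apply cf_upr]. apply cf_succ, cf_cpair; [assumption|apply cf_const].
Qed.

(* The validity of [z] is itself only semi-decidable, so its certificate is
   quantified universally along with [z]. *)
Lemma Pi2_der P (A : nat -> Prop) wf val dec :
  (forall n, A n <-> der P (wf, [n]) /\ forall z, der P (val, [n; z]) -> der P (dec, [n; z])) ->
  Pi2 A.
Proof.
  intro HA.
  (* [x] packs [z] with a certificate of its validity, [y] packs certificates for [wf] and [dec]. If
     the certificate in [x] fails, the second summand is zero and nothing is asked about [z]. *)
  set (F := fun n x y => check P (efact (wf, [n])) (upl y) +
    ifz (check P (efact (val, [n; upl x])) (upr x)) (check P (efact (dec, [n; upl x])) (upr y)) 0).
  assert (HF : cf 3 (fun xs => F (nth 0 xs 0) (nth 1 xs 0) (nth 2 xs 0))).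
  { assert (H0 := cf_proj (k := 3) (i := 0) ltac:(lia)).
    assert (H1 := cf_proj (k := 3) (i := 1) ltac:(lia)).
    assert (H2 := cf_proj (k := 3) (i := 2) ltac:(lia)).
    assert (Hf1 : forall t X, cf 3 X -> cf 3 (fun xs => efact (t, [X xs]))).
    { intros. unfold efact, node. cbn [fst snd]. apply cf_cpair; [apply cf_const|].
      apply cf_succ, cf_cpair; [assumption|apply cf_const]. }
    assert (Hf2 : forall t X Z, cf 3 X -> cf 3 Z -> cf 3 (fun xs => efact (t, [X xs; Z xs]))).
    { intros. unfold efact, node. cbn [fst snd]. apply cf_cpair; [apply cf_const|]. apply cf_succ, cf_cpair; [assumption|].
      apply cf_succ, cf_cpair; [assumption|apply cf_const]. }
    apply cf_add.
    - apply cf_check; [auto|now apply cf_upl].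
    - apply cf_ifz; [| |apply cf_const]; (apply cf_check; [apply Hf2|apply cf_upr]);
        auto; now apply cf_upl. }
  destruct HF as [p Hp]. exists p.
  assert (Hv : forall n x y, reval p [n; x; y] (F n x y)) by (intros; now apply (Hp [n; x; y])).
  split; [eauto|]. intro n. rewrite HA. clear HA.
  assert (Hd : forall n x y, F n x y = 0 <-> reval p [n; x; y] 0).
  { intros n' x y. split; [now intros <-|]. intro H. exact (reval_det (Hv n' x y) H). }
  split.
  - intros [Hw Hz] x. apply check_der in Hw as [y1 Hy1].
    destruct (check P (efact (val, [n; upl x])) (upr x)) eqn:E.
    + assert (Hx : der P (val, [n; upl x])) by (apply check_der; eauto).
      apply Hz, check_der in Hx as [y2 Hy2]. exists (cpair y1 y2). apply Hd.
      unfold F. now rewrite upl_cpair, upr_cpair, E, Hy1, Hy2.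
    + exists (cpair y1 0). apply Hd. unfold F. now rewrite upl_cpair, E, Hy1.
  - intro H. split.
    + destruct (H 0) as [y Hy]. apply Hd in Hy. unfold F in Hy. apply check_der.
      exists (upl y). lia.
    + intros z Hz. apply check_der in Hz as [w Hw]. destruct (H (cpair z w)) as [y Hy].
      apply Hd in Hy. unfold F in Hy. rewrite upl_cpair, upr_cpair, Hw in Hy. cbn [ifz] in Hy.
      apply check_der. exists (upr y). lia.
Qed.

(** * Codes of semantic objects *)

Fixpoint ty_nested_ind (Q : ty -> Prop) (hone : Q One)
  (hprod : forall a b, Q a -> Q b -> Q (Prod a b))
  (hsum : forall ts, Forall Q ts -> Q (Sum ts)) (t : ty) : Q t :=
  let rec := ty_nested_ind hone hprod hsum in
  match t with
  | One => hone
  | Prod a b => hprod a b (rec a) (rec b)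
  | Sum ts => hsum ts
      ((fix go l : Forall Q l :=
          match l with [] => Forall_nil Q | t :: l' => Forall_cons t (rec t) (go l') end) ts)
  end.

Lemma enc_ctx_inj_in G G' :
  Forall (fun t => forall t', enc_ty t = enc_ty t' -> t = t') G -> enc_ctx G = enc_ctx G' -> G = G'.
Proof.
  unfold enc_ctx. intros HG H. apply enc_list_inj in H. revert G' H.
  induction HG as [|t G Ht _ IH]; intros [|t' G'] H; try discriminate; [reflexivity|].
  injection H as H1 H2. f_equal; auto.
Qed.

Lemma enc_ty_inj t t' : enc_ty t = enc_ty t' -> t = t'.
Proof.
  revert t'. induction t as [|a b IHa IHb|ts IH] using ty_nested_ind; intros [|a' b'|ts'] H;
    apply cpair_inj in H as [Hk H]; try discriminate Hk; [reflexivity| |].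
  - apply enc_list_inj in H. injection H as H1 H2. f_equal; auto.
  - f_equal. now apply enc_ctx_inj_in.
Qed.

(** Dependent inversion as a term: it needs no equality between indices, and it computes when it is
    used to define handlers and operations. *)
Definition mem_inv {A} {y z : A} {l} (m : mem y (z :: l)) :
  forall P : forall y, mem y (z :: l) -> Type,
    P z (Here l) -> (forall y (m : mem y l), P y (There z m)) -> P y m :=
  match m in mem _ L return
    match L return mem y L -> Type with
    | [] => fun _ => unit
    | z :: l => fun m => forall P : forall y, mem y (z :: l) -> Type,
        P z (Here l) -> (forall y (m : mem y l), P y (There z m)) -> P y m
    end m
  with
  | Here l => fun P h _ => h
  | There z m => fun P _ h => h _ m
  end.

Definition mem_nil {A} {y : A} (m : mem y []) : False :=
  match m in mem _ L return match L with [] => False | _ => True end with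
  | Here _ => I
  | There _ _ => I
  end.

(** Memberships at equal positions coincide only after their indices are identified; phrasing this
    as transport of predicates avoids heterogeneous equality. *)
Lemma pos_transport {A} {x y : A} {l} (m : mem x l) (m' : mem y l) (Q : forall x, mem x l -> Prop) :
  pos m = pos m' -> Q x m -> Q y m'.
Proof.
  revert y m' Q. induction m as [l|z l m IH]; intros y m' Q.
  - refine (mem_inv m' (fun y m' => 0 = pos m' -> Q x (Here l) -> Q y m') _ _); cbn;
      [auto|discriminate].
  - refine (mem_inv m' (fun y m' => S (pos m) = pos m' -> Q x (There z m) -> Q y m') _ _); cbn;
      [discriminate|]. intros y' m'' [= H]. apply (IH _ m'' (fun x m => Q x (There z m)) H).
Qed.

Lemma op_transport (S : signature) a b (o : mem (a, b) S) a' b' (o' : mem (a', b') S)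
  (Q : forall a b, mem (a, b) S -> Prop) :
  pos o = pos o' -> Q a b o -> Q a' b' o'.
Proof.
  intro H. exact (pos_transport o o'
    (fun p => match p return mem p S -> Prop with (a, b) => Q a b end) H).
Qed.

Lemma nth_pos {A B} (f : A -> B) {x l} (m : mem x l) : nth_error (map f l) (pos m) = Some (f x).
Proof. induction m; cbn; auto. Qed.

Lemma pos_nth {A B} (f : A -> B) l i y :
  nth_error (map f l) i = Some y -> exists x (m : mem x l), pos m = i /\ f x = y.
Proof.
  revert i. induction l as [|z l IH]; intros [|i] H; try discriminate; cbn in H.
  - injection H as H. now exists z, (Here l).
  - destruct (IH _ H) as (x & m & <- & Hx). now exists x, (There z m).
Qed.

Definition esum (f : forall t, sem t -> nat) : forall ts, sum_of sem ts -> nat :=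
  fix go ts :=
    match ts return sum_of sem ts -> nat with
    | [] => fun s => match s with end
    | t :: ts' => fun s => match s with inl x => cpair 0 (f t x) | inr s' => cpair 1 (go ts' s') end
    end.

Fixpoint esem (t : ty) : sem t -> nat :=
  match t with
  | One => fun _ => 0
  | Prod a b => fun p => cpair (esem a (fst p)) (esem b (snd p))
  | Sum ts => esum esem ts
  end.
Arguments esem {t} _.

Definition eltsum (f : forall t, list (sem t)) : forall ts, list (sum_of sem ts) :=
  fix go ts :=
    match ts with
    | [] => []
    | t :: ts' => map inl (f t) ++ map inr (go ts')
    end.

Fixpoint elts (t : ty) : list (sem t) :=
  match t with
  | One => [tt]
  | Prod a b => list_prod (elts a) (elts b)
  | Sum ts => eltsum elts ts
  end.

Lemma esem_inj t (x y : sem t) : esem x = esem y -> x = y.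
Proof.
  revert x y. induction t as [|a b IHa IHb|ts IH] using ty_nested_ind.
  - now intros [] [].
  - intros [x1 x2] [y1 y2] H. apply cpair_inj in H as [H1 H2]. f_equal; auto.
  - cbn. induction IH as [|t ts Ht _ IH]; intros x y; [easy|].
    destruct x as [x|x], y as [y|y]; cbn; intro H; apply cpair_inj in H as [Hk H];
      try discriminate; f_equal; auto.
Qed.

Lemma elts_complete t (x : sem t) : In x (elts t).
Proof.
  revert x. induction t as [|a b IHa IHb|ts IH] using ty_nested_ind.
  - intros []. now left.
  - intros [x1 x2]. now apply in_prod.
  - cbn. induction IH as [|t ts Ht _ IH]; intros x; [easy|].
    apply in_or_app. destruct x as [x|x]; [left|right]; now apply in_map.
Qed.

Lemma elts_nodup t : NoDup (elts t).
Proof.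
  induction t as [|a b IHa IHb|ts IH] using ty_nested_ind; cbn.
  - repeat constructor. easy.
  - induction IHa as [|x l Hx _ IH]; cbn; [constructor|].
    apply NoDup_app; [| exact IH |].
    + apply FinFun.Injective_map_NoDup; [|assumption]. congruence.
    + intros [x' y] H1 H2. apply in_map_iff in H1 as (y' & [= -> ->] & _).
      now apply in_prod_iff in H2.
  - induction IH as [|t ts Ht _ IH]; cbn; [constructor|]. apply NoDup_app.
    + apply FinFun.Injective_map_NoDup; [|assumption]. congruence.
    + apply FinFun.Injective_map_NoDup; [|assumption]. congruence.
    + intros x H1 H2. apply in_map_iff in H1 as (y & <- & _).
      now apply in_map_iff in H2 as (z & [=] & _).
Qed.

(** Choice over a finite type needs no axiom: the function is assembled along the structure of the
    type. *)
Lemma sem_choice t (X : Type) (R : sem t -> X -> Prop) :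
  (forall y, exists x, R y x) -> exists f, forall y, R y (f y).
Proof.
  revert X R. induction t as [|a b IHa IHb|ts IH] using ty_nested_ind; intros X R H.
  - destruct (H tt) as [x Hx]. exists (fun _ => x). now intros [].
  - destruct (IHa (sem b -> X) (fun y1 f => forall y2, R (y1, y2) (f y2))) as [f Hf].
    + intro y1. apply (IHb X (fun y2 => R (y1, y2))). intro y2. apply H.
    + exists (fun p => f (fst p) (snd p)). intros [y1 y2]. apply Hf.
  - cbn in *. induction IH as [|t ts Ht _ IH].
    + exists (fun y : sum_of sem [] => match y with end). intros [].
    + destruct (Ht X (fun y => R (inl y))) as [f Hf]; [intro; apply H|].
      destruct (IH (fun y => R (inr y))) as [g Hg]; [intro; apply H|].
      exists (fun y => match y with inl z => f z | inr z => g z end). intros [y|y]; auto.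
Qed.

(** Decodes tables into functions. A choice function for membership in the zipped list is the right
    one because [elts t] has no repetition. *)
Lemma elts_map_surj t (X : Type) (xs : list X) :
  length xs = length (elts t) -> exists f, map f (elts t) = xs.
Proof.
  intro Hl. destruct (@sem_choice t X (fun y x => In (y, x) (combine (elts t) xs))) as [f Hf].
  - intro y. pose proof (elts_complete t y) as Hy. apply In_nth_error in Hy as [n Hn].
    destruct (nth_error xs n) as [x|] eqn:E.
    + exists x. clear Hl. revert xs n Hn E. generalize (elts t).
      induction l as [|z l IH]; intros [|x' xs] [|n] Hn E; try discriminate; cbn in *.
      * left. congruence.
      * right. eauto.
    + apply nth_error_None in E. assert (n < length (elts t)) by (apply nth_error_Some; congruence).
      lia.
  - exists f. pose proof (elts_nodup t) as Hd. 
    assert (Hf' : forall y, In y (elts t) -> In (y, f y) (combine (elts t) xs)) by auto.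
    clear Hf. revert xs Hl Hf'. induction Hd as [|y l Hy _ IH]; intros [|x xs] Hl Hf;
      try discriminate; [reflexivity|]. cbn in *. f_equal.
    + destruct (Hf y (or_introl eq_refl)) as [E|E]; [congruence|].
      now apply in_combine_l in E.
    + apply IH; [lia|]. intros z Hz. destruct (Hf z (or_intror Hz)) as [E|E]; [|assumption].
      congruence.
Qed.

Definition esig (S : signature) : nat :=
  enc_list (map (fun p => node 0 [enc_ty (fst p); enc_ty (snd p)]) S).
Definition ethy S (E : theory S) : nat := enc_list (map enc_eqn E).
Definition ehdl S (H : handler S) : nat := enc_list (@enc_handler_aux S S H).

Fixpoint esenv (G : list ty) : senv G -> nat :=
  match G return senv G -> nat with
  | [] => fun _ => 0
  | t :: G' => fun e => cpair (esem (fst e)) (esenv G' (snd e))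
  end.
Arguments esenv {G} _.

(** Arguments are stored next to the values, so that applying a coded function is a membership query
    in the clauses of [pZLK]. *)
Definition etbl {b} (f : sem b -> nat) (L : list (sem b)) : nat :=
  enc_list (map (fun y => cpair (esem y) (f y)) L).

Fixpoint etree {S} (t : tree S) : nat :=
  match t with
  | @Node _ a b o x k => cpair (pos o) (cpair (esem x) (etbl (fun y => etree (k y)) (elts b)))
  end.

Fixpoint ezenv {S} (Z : list ty) : zenv Z (tree S) -> nat :=
  match Z return zenv Z (tree S) -> nat with
  | [] => fun _ => 0
  | t :: Z' => fun b => cpair (etbl (fun y => etree (fst b y)) (elts t)) (ezenv Z' (snd b))
  end.
Arguments ezenv {S Z} _.

Lemma etbl_inj b (f g : sem b -> nat) L y : etbl f L = etbl g L -> In y L -> f y = g y.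
Proof.
  intros H. apply enc_list_inj in H. induction L as [|z L IH]; [easy|].
  cbn in H. injection H as H1 H2. apply cpair_inj in H1 as [_ H1]. intros [->|Hy]; auto.
Qed.

(** The conclusion is [teq], not equality: equal tables make the subtrees agree pointwise, which
    [teq_cong] accepts. *)
Lemma etree_inj S (E : theory S) t u : etree t = etree u -> teq E t u.
Proof.
  revert u. induction t as [a b o x k IH]. intros [a' b' o' x' k'] H. cbn [etree] in H.
  apply cpair_inj in H as [Ho H]. revert x' k' H.
  refine (@op_transport S a b o a' b' o' (fun a' b' o' => forall x' k',
    cpair (esem x) (etbl (fun y => etree (k y)) (elts b)) =
    cpair (esem x') (etbl (fun y => etree (k' y)) (elts b')) ->
    teq E (Node o x k) (Node o' x' k')) Ho _).
  intros x' k' H. apply cpair_inj in H as [Hx Hk]. apply esem_inj in Hx as ->.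
  apply teq_cong. intro y. apply IH. 
  exact (@etbl_inj b (fun y => etree (k y)) (fun y => etree (k' y)) _ y Hk (elts_complete b y)).
Qed.

Lemma nth_handler S0 l (H : forall a b, mem (a, b) l -> tmpl S0 [b] [a]) a b (o : mem (a, b) l) :
  nth_error (enc_handler_aux H) (pos o) = Some (enc_tmpl (H a b o)).
Proof.
  revert H. induction o as [l|[a' b'] l o IH]; intro H; cbn; [reflexivity|].
  apply (IH (fun a b m => H a b (There (a', b') m))).
Qed.

(** * A Horn program for handler correctness *)

Notation pTY := 0 (only parsing).
Notation pTYS := 1 (only parsing).
Notation pMEM := 2 (only parsing).
Notation pWFV := 3 (only parsing).
Notation pWFT := 4 (only parsing).
Notation pWFB := 5 (only parsing).
Notation pWSIG := 6 (only parsing).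
Notation pWTHY := 7 (only parsing).
Notation pWHDL := 8 (only parsing).
Notation pWF := 9 (only parsing).
Notation pEN := 10 (only parsing).
Notation pENS := 11 (only parsing).
Notation pPROD := 12 (only parsing).
Notation pTAG := 13 (only parsing).
Notation pISE := 14 (only parsing).
Notation pIST := 15 (only parsing).
Notation pISF := 16 (only parsing).
Notation pISZ := 17 (only parsing).
Notation pEVV := 18 (only parsing).
Notation pLK := 19 (only parsing).
Notation pINJ := 20 (only parsing).
Notation pZLK := 21 (only parsing).
Notation pEVT := 22 (only parsing).
Notation pEVB := 23 (only parsing).
Notation pEVF := 24 (only parsing).
Notation pOP := 25 (only parsing).
Notation pTEQ := 26 (only parsing).
Notation pTEQF := 27 (only parsing).
Notation pVAL := 28 (only parsing).
Notation pDEC := 29 (only parsing).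

Notation x0 := (HV 0) (only parsing).
Notation x1 := (HV 1) (only parsing).
Notation x2 := (HV 2) (only parsing).
Notation x3 := (HV 3) (only parsing).
Notation x4 := (HV 4) (only parsing).
Notation x5 := (HV 5) (only parsing).
Notation x6 := (HV 6) (only parsing).
Notation x7 := (HV 7) (only parsing).
Notation x8 := (HV 8) (only parsing).
Notation x9 := (HV 9) (only parsing).
Notation x10 := (HV 10) (only parsing).
Notation x11 := (HV 11) (only parsing).

Definition hnil : hterm := HC 0.
Definition hcons (t u : hterm) : hterm := HS (HP t u).
Definition hnode (k : nat) (l : list hterm) : hterm := HP (HC k) (fold_right hcons hnil l).

(* The clauses of predicate number [i] form the [i]-th list.  Environments and
   valuations are nested pairs ending in [0].  In pEVT, pEVB, pEVF and pOP the first
   argument selects the operations: [0] for the free ones, [S h] for those of the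
   handler with code [h]. *)
Definition program : list (list clause) := [
  [ ((pTY, [hnode 0 []]), []);
    ((pTY, [hnode 1 [x0; x1]]), [(pTY, [x0]); (pTY, [x1])]);
    ((pTY, [HP (HC 2) x0]), [(pTYS, [x0])]) ];
  (* pTYS context *)
  [ ((pTYS, [hnil]), []);
    ((pTYS, [hcons x0 x1]), [(pTY, [x0]); (pTYS, [x1])]) ];
  (* pMEM list index element *)
  [ ((pMEM, [hcons x0 x1; hnil; x0]), []);
    ((pMEM, [hcons x0 x1; HS x2; x3]), [(pMEM, [x1; x2; x3])]) ];
  (* pWFV context type value *)
  [ ((pWFV, [x0; x1; hnode 0 [x1; x2]]), [(pMEM, [x0; x2; x1])]);
    ((pWFV, [x0; hnode 0 []; hnode 1 []]), []);
    ((pWFV, [x0; hnode 1 [x1; x2]; hnode 2 [x1; x2; x3; x4]]),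
       [(pWFV, [x0; x1; x3]); (pWFV, [x0; x2; x4])]);
    ((pWFV, [x0; HP (HC 2) x1; hnode 3 [x1; x2; x3; x4]]),
       [(pMEM, [x1; x3; x2]); (pWFV, [x0; x2; x4])]) ];
  (* pWFT signature template-context context template *)
  [ ((pWFT, [x0; x1; x2; hnode 0 [x3; x4; x5]]),
       [(pMEM, [x1; x4; x3]); (pWFV, [x2; x3; x5])]);
    ((pWFT, [x0; x1; x2; hnode 1 [x3; x4; x5; x6]]),
       [(pTY, [x3]); (pTY, [x4]); (pWFV, [x2; hnode 1 [x3; x4]; x5]);
        (pWFT, [x0; x1; hcons x4 (hcons x3 x2); x6])]);
    ((pWFT, [x0; x1; x2; hnode 2 [x3; x4; x5]]),
       [(pTYS, [x3]); (pWFV, [x2; HP (HC 2) x3; x4]); (pWFB, [x0; x1; x2; x3; x5])]);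
    ((pWFT, [x0; x1; x2; hnode 3 [x3; x4; x5; x6; x7]]),
       [(pMEM, [x0; x5; hnode 0 [x3; x4]]); (pWFV, [x2; x3; x6]);
        (pWFT, [x0; x1; hcons x4 x2; x7])]) ];
  (* pWFB signature template-context context summands branches *)
  [ ((pWFB, [x0; x1; x2; hnil; hnil]), []);
    ((pWFB, [x0; x1; x2; hcons x3 x4; hcons x5 x6]),
       [(pWFT, [x0; x1; hcons x3 x2; x5]); (pWFB, [x0; x1; x2; x4; x6])]) ];
  [ ((pWSIG, [hnil]), []);
    ((pWSIG, [hcons (hnode 0 [x0; x1]) x2]), [(pTY, [x0]); (pTY, [x1]); (pWSIG, [x2])]) ];
  (* pWTHY signature theory *)
  [ ((pWTHY, [x0; hnil]), []);
    ((pWTHY, [x0; hcons (hnode 0 [x1; x2; x3; x4]) x5]),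
       [(pTYS, [x1]); (pTYS, [x2]); (pWFT, [x0; x2; x1; x3]); (pWFT, [x0; x2; x1; x4]);
        (pWTHY, [x0; x5])]) ];
  (* pWHDL signature handled-operations handler *)
  [ ((pWHDL, [x0; hnil; hnil]), []);
    ((pWHDL, [x0; hcons (hnode 0 [x1; x2]) x3; hcons x4 x5]),
       [(pWFT, [x0; hcons x2 hnil; hcons x1 hnil; x4]); (pWHDL, [x0; x3; x5])]) ];
  [ ((pWF, [hnode 0 [x0; x1; x2]]),
       [(pWSIG, [x0]); (pWTHY, [x0; x1]); (pWHDL, [x0; x0; x2])]) ];
  (* pEN type elements *)
  [ ((pEN, [hnode 0 []; hcons hnil hnil]), []);
    ((pEN, [hnode 1 [x0; x1]; x2]), [(pEN, [x0; x3]); (pEN, [x1; x4]); (pPROD, [x3; x4; x2])]);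
    ((pEN, [HP (HC 2) x0; x1]), [(pENS, [x0; x1])]) ];
  (* pENS summands elements *)
  [ ((pENS, [hnil; hnil]), []);
    ((pENS, [hcons x0 x1; x2]),
       [(pEN, [x0; x3]); (pENS, [x1; x4]); (pTAG, [HC 1; x4; hnil; x5]);
        (pTAG, [HC 0; x3; x5; x2])]) ];
  (* pPROD list list product *)
  [ ((pPROD, [hnil; x0; hnil]), []);
    ((pPROD, [hcons x0 x1; x2; x3]), [(pPROD, [x1; x2; x4]); (pTAG, [x0; x2; x4; x3])]) ];
  (* pTAG tag list rest result *)
  [ ((pTAG, [x0; hnil; x1; x1]), []);
    ((pTAG, [x0; hcons x1 x2; x3; hcons (HP x0 x1) x4]), [(pTAG, [x0; x2; x3; x4])]) ];
  (* pISE context environment *)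
  [ ((pISE, [hnil; hnil]), []);
    ((pISE, [hcons x0 x1; HP x2 x3]),
       [(pEN, [x0; x4]); (pMEM, [x4; x5; x2]); (pISE, [x1; x3])]) ];
  (* pIST signature tree *)
  [ ((pIST, [x0; HP x1 (HP x2 x3)]),
       [(pMEM, [x0; x1; hnode 0 [x4; x5]]); (pEN, [x4; x6]); (pMEM, [x6; x7; x2]);
        (pEN, [x5; x8]); (pISF, [x0; x8; x3])]) ];
  (* pISF signature arguments table *)
  [ ((pISF, [x0; hnil; hnil]), []);
    ((pISF, [x0; hcons x1 x2; hcons (HP x1 x3) x4]), [(pIST, [x0; x3]); (pISF, [x0; x2; x4])]) ];
  (* pISZ signature template-context valuation *)
  [ ((pISZ, [x0; hnil; hnil]), []);
    ((pISZ, [x0; hcons x1 x2; HP x3 x4]),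
       [(pEN, [x1; x5]); (pISF, [x0; x5; x3]); (pISZ, [x0; x2; x4])]) ];
  (* pEVV value environment result *)
  [ ((pEVV, [hnode 0 [x0; x1]; x2; x3]), [(pLK, [x1; x2; x3])]);
    ((pEVV, [hnode 1 []; x0; hnil]), []);
    ((pEVV, [hnode 2 [x0; x1; x2; x3]; x4; HP x5 x6]),
       [(pEVV, [x2; x4; x5]); (pEVV, [x3; x4; x6])]);
    ((pEVV, [hnode 3 [x0; x1; x2; x3]; x4; x5]),
       [(pEVV, [x3; x4; x6]); (pINJ, [x2; x6; x5])]) ];
  (* pLK index environment result *)
  [ ((pLK, [hnil; HP x0 x1; x0]), []);
    ((pLK, [HS x0; HP x1 x2; x3]), [(pLK, [x0; x2; x3])]) ];
  (* pINJ index element result *)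
  [ ((pINJ, [hnil; x0; HP (HC 0) x0]), []);
    ((pINJ, [HS x0; x1; HP (HC 1) x2]), [(pINJ, [x0; x1; x2])]) ];
  (* pZLK index valuation element result *)
  [ ((pZLK, [hnil; HP x0 x1; x2; x3]), [(pMEM, [x0; x4; HP x2 x3])]);
    ((pZLK, [HS x0; HP x1 x2; x3; x4]), [(pZLK, [x0; x2; x3; x4])]) ];
  (* pEVT operations valuation template environment result *)
  [ ((pEVT, [x0; x1; hnode 0 [x2; x3; x4]; x5; x6]),
       [(pEVV, [x4; x5; x7]); (pZLK, [x3; x1; x7; x6])]);
    ((pEVT, [x0; x1; hnode 1 [x2; x3; x4; x5]; x6; x7]),
       [(pEVV, [x4; x6; HP x8 x9]); (pEVT, [x0; x1; x5; HP x9 (HP x8 x6); x7])]);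
    ((pEVT, [x0; x1; hnode 2 [x2; x3; x4]; x5; x6]),
       [(pEVV, [x3; x5; x7]); (pEVB, [x0; x1; x4; x5; x7; x6])]);
    ((pEVT, [x0; x1; hnode 3 [x2; x3; x4; x5; x6]; x7; x8]),
       [(pEVV, [x5; x7; x9]); (pEN, [x3; x10]); (pEVF, [x0; x1; x6; x7; x10; x11]);
        (pOP, [x0; x4; x9; x11; x8])]) ];
  (* pEVB operations valuation branches environment scrutinee result *)
  [ ((pEVB, [x0; x1; hcons x2 x3; x4; HP (HC 0) x5; x6]),
       [(pEVT, [x0; x1; x2; HP x5 x4; x6])]);
    ((pEVB, [x0; x1; hcons x2 x3; x4; HP (HC 1) x5; x6]),
       [(pEVB, [x0; x1; x3; x4; x5; x6])]) ];
  (* pEVF operations valuation template environment arguments table *)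
  [ ((pEVF, [x0; x1; x2; x3; hnil; hnil]), []);
    ((pEVF, [x0; x1; x2; x3; hcons x4 x5; hcons (HP x4 x6) x7]),
       [(pEVT, [x0; x1; x2; HP x4 x3; x6]); (pEVF, [x0; x1; x2; x3; x5; x7])]) ];
  (* pOP operations index parameter table result *)
  [ ((pOP, [hnil; x0; x1; x2; HP x0 (HP x1 x2)]), []);
    ((pOP, [HS x0; x1; x2; x3; x4]),
       [(pMEM, [x0; x1; x5]); (pEVT, [hnil; HP x3 hnil; x5; HP x2 hnil; x4])]) ];
  (* pTEQ signature theory tree tree *)
  [ ((pTEQ, [x0; x1; x2; x2]), []);
    ((pTEQ, [x0; x1; x2; x3]), [(pTEQ, [x0; x1; x3; x2])]);
    ((pTEQ, [x0; x1; x2; x3]),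
       [(pIST, [x0; x4]); (pTEQ, [x0; x1; x2; x4]); (pTEQ, [x0; x1; x4; x3])]);
    ((pTEQ, [x0; x1; HP x2 (HP x3 x4); HP x2 (HP x3 x5)]), [(pTEQF, [x0; x1; x4; x5])]);
    ((pTEQ, [x0; x1; x2; x3]),
       [(pMEM, [x1; x4; hnode 0 [x5; x6; x7; x8]]); (pISE, [x5; x9]); (pISZ, [x0; x6; x10]);
        (pEVT, [hnil; x10; x7; x9; x2]); (pEVT, [hnil; x10; x8; x9; x3])]) ];
  (* pTEQF signature theory table table *)
  [ ((pTEQF, [x0; x1; hnil; hnil]), []);
    ((pTEQF, [x0; x1; hcons (HP x2 x3) x4; hcons (HP x2 x5) x6]),
       [(pTEQ, [x0; x1; x3; x5]); (pTEQF, [x0; x1; x4; x6])]) ];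
  (* pVAL instance (equation, (environment, valuation)) *)
  [ ((pVAL, [hnode 0 [x0; x1; x2]; HP x3 (HP x4 x5)]),
       [(pMEM, [x1; x3; hnode 0 [x6; x7; x8; x9]]); (pISE, [x6; x4]); (pISZ, [x0; x7; x5])]) ];
  (* pDEC instance (equation, (environment, valuation)) *)
  [ ((pDEC, [hnode 0 [x0; x1; x2]; HP x3 (HP x4 x5)]),
       [(pMEM, [x1; x3; hnode 0 [x6; x7; x8; x9]]);
        (pEVT, [HS x2; x5; x8; x4; x10]); (pEVT, [HS x2; x5; x9; x4; x11]);
        (pTEQ, [x0; x1; x10; x11])]) ]
].

(** * Soundness of the Horn program *)

Definition opsrep S (m : nat) (ops : opsT S (tree S)) : Prop :=
  (m = 0 /\ ops = @tree_ops S) \/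
  (exists H : handler S, m = Datatypes.S (ehdl H) /\ ops = handler_ops H).

(** Predicates that recognise codes assert that a decoded object exists. Those that compute or
    compare are conditional on their inputs being codes, so their clauses need not repeat type
    checks. Facts of a wrong shape mean [True]. *)
Definition meaning (f : hfact) : Prop :=
  match fst f, snd f with
  | pTY, [c] => exists t, enc_ty t = c
  | pTYS, [c] => exists G, enc_ctx G = c
  | pMEM, [c; i; x] => forall l, enc_list l = c -> nth_error l i = Some x
  | pWFV, [g; c; v] => forall G t, enc_ctx G = g -> enc_ty t = c ->
      exists w : val G t, enc_val w = v
  | pWFT, [s; z; g; c] => forall S Z G, esig S = s -> enc_ctx Z = z -> enc_ctx G = g ->
      exists T : tmpl S Z G, enc_tmpl T = c
  | pWFB, [s; z; g; cs; c] => forall S Z G ts, esig S = s -> enc_ctx Z = z ->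
      enc_ctx G = g -> enc_ctx ts = cs ->
      exists B : branches S Z G ts, enc_list (enc_brs B) = c
  | pWSIG, [s] => exists S, esig S = s
  | pWTHY, [s; c] => forall S, esig S = s -> exists E : theory S, ethy E = c
  | pWHDL, [s; s'; c] => forall S S', esig S = s -> esig S' = s' ->
      exists H : (forall a b, mem (a, b) S' -> tmpl S [b] [a]), enc_list (enc_handler_aux H) = c
  | pWF, [n] => exists I, enc_instance I = n
  | pEN, [c; l] => forall t, enc_ty t = c -> l = enc_list (map esem (elts t))
  | pENS, [c; l] => forall ts, enc_ctx ts = c -> l = enc_list (map (esum (@esem) ts) (eltsum elts ts))
  | pPROD, [a; b; c] => forall l l', enc_list l = a -> enc_list l' = b ->
      c = enc_list (map (fun p => cpair (fst p) (snd p)) (list_prod l l'))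
  | pTAG, [x; a; b; c] => forall l l', enc_list l = a -> enc_list l' = b ->
      c = enc_list (map (cpair x) l ++ l')
  | pISE, [g; e] => forall G, enc_ctx G = g -> exists d : senv G, esenv d = e
  | pIST, [s; c] => forall S, esig S = s -> exists t : tree S, etree t = c
  | pISF, [s; a; c] => forall S l, esig S = s -> enc_list l = a ->
      exists ts : list (tree S), length ts = length l /\
        c = enc_list (map (fun p => cpair (fst p) (etree (snd p))) (combine l ts))
  | pISZ, [s; z; c] => forall S Z, esig S = s -> enc_ctx Z = z ->
      exists bv : zenv Z (tree S), ezenv bv = c
  | pEVV, [v; e; r] => forall G t (w : val G t) d, enc_val w = v -> esenv d = e ->
      r = esem (evv w d)
  | pLK, [p; e; r] => forall G t (m : mem t G) d, pos m = p -> esenv d = e ->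
      r = esem (lookup m d)
  | pINJ, [p; x; r] => forall ts t (m : mem t ts) y, pos m = p -> esem y = x ->
      r = esum (@esem) ts (inj m y)
  | pZLK, [p; c; x; r] => forall S Z t (m : mem t Z) (bv : zenv Z (tree S)) y,
      pos m = p -> ezenv bv = c -> esem y = x -> r = etree (zlookup m bv y)
  | pEVT, [m; c; k; e; r] => forall S (ops : opsT S (tree S)) Z bv G (T : tmpl S Z G) d,
      opsrep m ops -> ezenv bv = c -> enc_tmpl T = k -> esenv d = e ->
      r = etree (evt ops bv T d)
  | pEVB, [m; c; k; e; x; r] =>
      forall S (ops : opsT S (tree S)) Z bv G ts (B : branches S Z G ts) d y,
      opsrep m ops -> ezenv bv = c -> enc_list (enc_brs B) = k -> esenv d = e ->
      esum (@esem) ts y = x -> r = etree (evb ops bv B d y)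
  | pEVF, [m; c; k; e; l; r] =>
      forall S (ops : opsT S (tree S)) Z bv G b (T : tmpl S Z (b :: G)) d L,
      opsrep m ops -> ezenv bv = c -> enc_tmpl T = k -> esenv d = e ->
      enc_list (map esem L) = l ->
      r = etbl (fun y => etree (evt ops bv T (y, d))) L
  | pOP, [m; p; x; k; r] =>
      forall S (ops : opsT S (tree S)) a b (o : mem (a, b) S) y f,
      opsrep m ops -> pos o = p -> esem y = x -> etbl (fun y => etree (f y)) (elts b) = k ->
      r = etree (ops a b o y f)
  | pTEQ, [s; c; t; u] => forall S (E : theory S) t' u', esig S = s -> ethy E = c ->
      etree t' = t -> etree u' = u -> teq E t' u'
  | pTEQF, [s; c; k; k'] => forall S (E : theory S) b (f g : sem b -> tree S) L,
      esig S = s -> ethy E = c ->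
      etbl (fun y => etree (f y)) L = k -> etbl (fun y => etree (g y)) L = k' ->
      forall y, In y L -> teq E (f y) (g y)
  | pVAL, [n; z] => forall I, enc_instance I = n ->
      exists i q (env : senv (eG q)) (bv : zenv (eZ q) (tree (i_sig I))),
        nth_error (i_thy I) i = Some q /\ z = cpair i (cpair (esenv env) (ezenv bv))
  | pDEC, [n; z] => forall I i q env (bv : zenv (eZ q) (tree (i_sig I))),
      enc_instance I = n -> nth_error (i_thy I) i = Some q ->
      z = cpair i (cpair (esenv env) (ezenv bv)) ->
      teq (i_thy I) (evt (handler_ops (i_hdl I)) bv (lhs q) env)
        (evt (handler_ops (i_hdl I)) bv (rhs q) env)
  | _, _ => True
  end.

Fixpoint all_of (l : list Prop) : Prop := match l with [] => True | p :: l' => p /\ all_of l' end.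

Definition sound_clause (c : clause) : Prop :=
  forall e, all_of (map (fun b => meaning (inst e b)) (snd c)) -> meaning (inst e (fst c)).

Lemma der_sound f :
  Forall (Forall sound_clause) program -> der (concat program) f -> meaning f.
Proof.
  intros HP. induction 1 as [c e Hc _ IH].
  apply in_concat in Hc as (cs & Hcs & Hc).
  rewrite Forall_forall in HP. specialize (HP _ Hcs). rewrite Forall_forall in HP.
  apply (HP _ Hc). clear - IH. induction (snd c) as [|b bs IHb]; cbn; [exact I|].
  split; [apply IH; now left|]. apply IHb. intros. apply IH. now right.
Qed.

Ltac start :=
  let e := fresh "e" in intro e; unfold hnode, hnil, hcons; cbn -[var enc_list enc_ctx enc_ty enc_val enc_tmpl enc_brs];
  repeat match goal with |- context [var ?i e] => generalize (var i e); intro end; clear e.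

Ltac codes :=
  repeat match goal with
  | H : node _ _ = _ |- _ => unfold node in H
  | H : context [enc_list (?x :: ?l)] |- _ =>
      change (enc_list (x :: l)) with (S (cpair x (enc_list l))) in H
  | H : context [enc_list []] |- _ => change (enc_list []) with 0 in H
  | H : cpair _ _ = cpair _ _ |- _ => apply cpair_inj in H as []
  | H : S _ = S _ |- _ => apply eq_add_S in H
  | H : ?x = ?x |- _ => clear H
  | H : 0 = S _ |- _ => discriminate H
  | H : S _ = 0 |- _ => discriminate H
  end.


Lemma sound_TY : Forall sound_clause (nth pTY program []).
Proof.
  repeat apply Forall_cons; try apply Forall_nil; start.
  - intros _. now exists One.
  - intros ((a & <-) & (b & <-) & _). now exists (Prod a b).
  - intros ((G & <-) & _). now exists (Sum G).
Qed.

Lemma sound_TYS : Forall sound_clause (nth pTYS program []).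
Proof.
  repeat apply Forall_cons; try apply Forall_nil; start.
  - intros _. now exists [].
  - intros ((t & <-) & (G & <-) & _). now exists (t :: G).
Qed.

Lemma sound_MEM : Forall sound_clause (nth pMEM program []).
Proof.
  repeat apply Forall_cons; try apply Forall_nil; start.
  - intros _ [|y l] H; cbn in H; codes. now subst.
  - intros (H1 & _) [|y l] H; cbn in H; codes. auto.
Qed.

Lemma sound_WFV : Forall sound_clause (nth pWFV program []).
Proof.
  repeat apply Forall_cons; try apply Forall_nil; start.
  - intros (H & _) G t <- <-. specialize (H _ eq_refl).
    apply pos_nth in H as (t' & m & <- & Ht). apply enc_ty_inj in Ht as ->.
    now exists (VVar m).
  - intros _ G [| |] _ H; cbn in H; codes; try discriminate. now exists (VUnit G).
  - intros (H1 & H2 & _) G [|a b|] HG H; cbn in H; codes; try discriminate.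
    destruct (H1 G a) as [v <-]; [assumption..|]. destruct (H2 G b) as [w <-]; [assumption..|].
    subst. now exists (VPair v w).
  - intros (H1 & H2 & _) G [| |ts] HG H; cbn in H; codes; try discriminate.
    pose proof (H1 _ H0) as H. apply pos_nth in H as (t & m & <- & Ht).
    destruct (H2 G t) as [w <-]; [assumption..|]. subst.
    now exists (VInj m w).
Qed.

Lemma sound_WFT : Forall sound_clause (nth pWFT program []).
Proof.
  repeat apply Forall_cons; try apply Forall_nil; start.
  - intros (H1 & H2 & _) S Z G HS HZ HG. apply H1 in HZ.
    apply pos_nth in HZ as (t & m & <- & Ht). destruct (H2 G t) as [v <-]; [assumption..|].
    exists (TVar S m v). cbn. now subst.
  - intros ((a & Ha) & (b & Hb) & H1 & H2 & _) S Z G HS HZ HG.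
    destruct (H1 G (Prod a b)) as [v <-]; [assumption|cbn; now subst|].
    destruct (H2 S Z (b :: a :: G)) as [T <-]; [assumption..|cbn; now subst|].
    exists (TSplit v T). cbn. now subst.
  - intros ((ts & Hts) & H1 & H2 & _) S Z G HS HZ HG.
    destruct (H1 G (Sum ts)) as [v <-]; [assumption|cbn; now subst|].
    destruct (H2 S Z G ts) as [B <-]; [assumption..|].
    exists (TCase v B). cbn. now subst.
  - intros (H1 & H2 & H3 & _) S Z G HS HZ HG. pose proof (H1 _ HS) as H.
    apply pos_nth in H as ([a b] & m & <- & Ht). cbn in Ht. codes.
    destruct (H2 G a) as [v <-]; [assumption..|].
    destruct (H3 S Z (b :: G)) as [T <-]; [assumption..|cbn; now subst|].
    exists (TOp m v T). cbn. now subst.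
Qed.

Lemma sound_WFB : Forall sound_clause (nth pWFB program []).
Proof.
  repeat apply Forall_cons; try apply Forall_nil; start.
  - intros _ S Z G [|t ts] HS HZ HG H; cbn in H; codes. now exists (BNil S Z G).
  - intros (H1 & H2 & _) S Z G [|t ts] HS HZ HG H; cbn in H; codes.
    destruct (H1 S Z (t :: G)) as [T <-]; [assumption..|cbn; now subst|].
    destruct (H2 S Z G ts) as [B <-]; [assumption..|].
    now exists (BCons T B).
Qed.

Lemma sound_WSIG : Forall sound_clause (nth pWSIG program []).
Proof.
  repeat apply Forall_cons; try apply Forall_nil; start.
  - intros _. now exists [].
  - intros ((a & <-) & (b & <-) & (S & <-) & _). now exists ((a, b) :: S).
Qed.

Lemma sound_WTHY : Forall sound_clause (nth pWTHY program []).
Proof.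
  repeat apply Forall_cons; try apply Forall_nil; start.
  - intros _ S _. now exists [].
  - intros ((G & <-) & (Z & <-) & H1 & H2 & H3 & _) S HS.
    destruct (H1 S Z G) as [l <-]; [assumption|reflexivity..|].
    destruct (H2 S Z G) as [r <-]; [assumption|reflexivity..|].
    destruct (H3 S) as [E <-]; [assumption|].
    now exists (mkEqn l r :: E).
Qed.

Lemma sound_WHDL : Forall sound_clause (nth pWHDL program []).
Proof.
  repeat apply Forall_cons; try apply Forall_nil; start.
  - intros _ S [|p S'] _ H; cbn in H; codes.
    now exists (fun a b (m : mem (a, b) []) => False_rect _ (mem_nil m)).
  - intros (H1 & H2 & _) S [|[a b] S'] HS H; cbn in H; codes.
    destruct (H1 S [b] [a]) as [T <-]; [assumption|cbn; now subst..|].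
    destruct (H2 S S') as [H' <-]; [assumption..|].
    now exists (fun a' b' (m : mem (a', b') ((a, b) :: S')) =>
      mem_inv m (fun p _ => match p with (a, b) => tmpl S [b] [a] end)
        T (fun p => match p with (a, b) => fun m => H' a b m end)).
Qed.

Lemma sound_WF : Forall sound_clause (nth pWF program []).
Proof.
  repeat apply Forall_cons; try apply Forall_nil; start.
  intros ((S & <-) & H1 & H2 & _). destruct (H1 S eq_refl) as [E <-].
  destruct (H2 S S eq_refl eq_refl) as [H <-]. now exists (mkInstance E H).
Qed.

Lemma sound_EN : Forall sound_clause (nth pEN program []).
Proof.
  repeat apply Forall_cons; try apply Forall_nil; start.
  - intros _ [| |] H; cbn in H; codes; try discriminate. reflexivity.
  - intros (H1 & H2 & H3 & _) [|a b|] H; cbn in H; codes; try discriminate.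
    rewrite (H3 _ _ (eq_sym (H1 a ltac:(eassumption))) (eq_sym (H2 b ltac:(eassumption)))). f_equal. cbn.
    induction (elts a) as [|x l IH]; cbn; [reflexivity|].
    rewrite !map_app, IH. f_equal. now rewrite !map_map.
  - intros (H1 & _) [| |ts] H; cbn in H; codes; try discriminate. now apply H1.
Qed.

Lemma sound_ENS : Forall sound_clause (nth pENS program []).
Proof.
  repeat apply Forall_cons; try apply Forall_nil; start.
  - intros _ [|t ts] H; cbn in H; codes. reflexivity.
  - intros (H1 & H2 & H3 & H4 & _) [|t ts] H; cbn in H; codes.
    specialize (H3 _ [] (eq_sym (H2 ts H0)) eq_refl). rewrite app_nil_r in H3.
    rewrite (H4 _ _ (eq_sym (H1 t H)) (eq_sym H3)). cbn.
    now rewrite map_app, !map_map.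
Qed.

Lemma sound_PROD : Forall sound_clause (nth pPROD program []).
Proof.
  repeat apply Forall_cons; try apply Forall_nil; start.
  - intros _ [|x l] l' H _; cbn in H; codes. reflexivity.
  - intros (H1 & H2 & _) [|x l] l' H H'; cbn in H; codes.
    rewrite (H2 _ _ H' (eq_sym (H1 l l' H0 H'))). cbn. rewrite map_app, map_map. now subst.
Qed.

Lemma sound_TAG : Forall sound_clause (nth pTAG program []).
Proof.
  repeat apply Forall_cons; try apply Forall_nil; start.
  - intros _ [|x l] l' H H'; cbn in H; codes. now symmetry.
  - intros (H1 & _) [|x l] l' H H'; cbn in H; codes.
    rewrite (H1 _ _ H0 H'). now subst.
Qed.

Lemma sound_ISE : Forall sound_clause (nth pISE program []).
Proof.
  repeat apply Forall_cons; try apply Forall_nil; start.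
  - intros _ [|t G] H; cbn in H; codes. now exists (tt : senv []).
  - intros (H1 & H2 & H3 & _) [|t G] H; cbn in H; codes.
    specialize (H2 _ (eq_sym (H1 t H))). apply pos_nth in H2 as (x & _ & _ & <-).
    destruct (H3 G H0) as [d <-]. now exists ((x, d) : senv (t :: G)).
Qed.

Lemma combine_etbl S b (f : sem b -> tree S) L :
  enc_list (map (fun p => cpair (fst p) (etree (snd p))) (combine (map esem L) (map f L))) =
  etbl (fun y => etree (f y)) L.
Proof. unfold etbl. f_equal. induction L; cbn; congruence. Qed.

Lemma sound_IST : Forall sound_clause (nth pIST program []).
Proof.
  repeat apply Forall_cons; try apply Forall_nil; start.
  intros (H1 & H2 & H3 & H4 & H5 & _) S HS. pose proof (H1 _ HS) as H.
  apply pos_nth in H as ([a b] & o & <- & Ho). cbn in Ho. codes.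
  specialize (H3 _ (eq_sym (H2 a ltac:(eassumption)))). apply pos_nth in H3 as (x & _ & _ & <-).
  destruct (H5 S _ HS (eq_sym (H4 b ltac:(eassumption)))) as (ts & Hl & ->).
  rewrite length_map in Hl. apply elts_map_surj in Hl as [f <-].
  exists (Node o x f). now rewrite combine_etbl.
Qed.

Lemma sound_ISF : Forall sound_clause (nth pISF program []).
Proof.
  repeat apply Forall_cons; try apply Forall_nil; start.
  - intros _ S [|x l] _ H; cbn in H; codes. now exists [].
  - intros (H1 & H2 & _) S [|x l] HS H; cbn in H; codes.
    destruct (H1 S HS) as [t <-]. destruct (H2 S l HS H0) as (ts & Hl & ->).
    exists (t :: ts). cbn. split; [now rewrite Hl|now subst].
Qed.

Lemma sound_ISZ : Forall sound_clause (nth pISZ program []).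
Proof.
  repeat apply Forall_cons; try apply Forall_nil; start.
  - intros _ S [|t Z] _ H; cbn in H; codes. now exists (tt : zenv [] (tree S)).
  - intros (H1 & H2 & H3 & _) S [|t Z] HS H; cbn in H; codes.
    destruct (H2 S _ HS (eq_sym (H1 t H))) as (ts & Hl & ->).
    rewrite length_map in Hl. apply elts_map_surj in Hl as [f <-].
    destruct (H3 S Z HS H0) as [bv <-].
    exists ((f, bv) : zenv (t :: Z) (tree S)). now rewrite combine_etbl.
Qed.

Lemma sound_EVV : Forall sound_clause (nth pEVV program []).
Proof.
  repeat apply Forall_cons; try apply Forall_nil; start.
  - intros (H1 & _) G t w d H Hd. destruct w; cbn in H; codes; try discriminate. now apply H1.
  - intros _ G t w d H Hd. destruct w; cbn in H; codes; try discriminate. reflexivity.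
  - intros (H1 & H2 & _) G t w d H Hd. destruct w; cbn in H; codes; try discriminate.
    cbn. f_equal; auto.
  - intros (H1 & H2 & _) G t w d H Hd. destruct w; cbn in H; codes; try discriminate.
    cbn. apply H2; [assumption|]. symmetry. auto.
Qed.

Lemma sound_LK : Forall sound_clause (nth pLK program []).
Proof.
  repeat apply Forall_cons; try apply Forall_nil; start.
  - intros _ G t m d H Hd. destruct m; cbn in H, Hd; codes. cbn. congruence.
  - intros (H1 & _) G t m d H Hd. destruct m; cbn in H, Hd; codes. cbn. now apply H1.
Qed.

Lemma sound_INJ : Forall sound_clause (nth pINJ program []).
Proof.
  repeat apply Forall_cons; try apply Forall_nil; start.
  - intros _ ts t m y H Hy. destruct m; cbn in H; codes. cbn. now subst.
  - intros (H1 & _) ts t m y H Hy. destruct m; cbn in H; codes. cbn. f_equal. now apply H1.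
Qed.

Lemma sound_ZLK : Forall sound_clause (nth pZLK program []).
Proof.
  repeat apply Forall_cons; try apply Forall_nil; start.
  - intros (H1 & _) S Z t m bv y H Hb Hy. destruct m; cbn in H, Hb; codes. cbn.
    apply H1 in H0. apply pos_nth in H0 as (z & _ & _ & Hz). codes.
    assert (z = y) by (apply esem_inj; congruence). congruence.
  - intros (H1 & _) S Z t m bv y H Hb Hy. destruct m; cbn in H, Hb; codes. cbn. now apply H1.
Qed.

Lemma sound_EVT : Forall sound_clause (nth pEVT program []).
Proof.
  repeat apply Forall_cons; try apply Forall_nil; start.
  - intros (H1 & H2 & _) S ops Z bv G T d Ho Hb H Hd.
    destruct T; cbn in H; codes; try discriminate. cbn.
    apply H2; [assumption..|]. symmetry. now apply H1.
  - intros (H1 & H2 & _) S ops Z bv G T d Ho Hb H Hd.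
    destruct T; cbn in H; codes; try discriminate. cbn.
    specialize (H1 _ _ v d ltac:(assumption) Hd). cbn in H1. codes.
    apply H2; [assumption..|]. cbn. congruence.
  - intros (H1 & H2 & _) S ops Z bv G T d Ho Hb H Hd.
    destruct T; cbn in H; codes; try discriminate. cbn.
    apply H2; [assumption..|]. symmetry. now apply (H1 _ _ v).
  - intros (H1 & H2 & H3 & H4 & _) S ops Z bv G T d Ho Hb H Hd.
    destruct T; cbn in H; codes; try discriminate. cbn.
    apply H4; [assumption..| |]; symmetry; [now apply H1|].
    apply H3; [assumption..|]. symmetry. auto.
Qed.

Lemma sound_EVB : Forall sound_clause (nth pEVB program []).
Proof.
  repeat apply Forall_cons; try apply Forall_nil; start.
  - intros (H1 & _) S ops Z bv G ts B d y Ho Hb H Hd Hy.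
    destruct B as [|G t ts T B]; cbn in H; codes. destruct y as [y|y]; cbn in Hy; codes;
      try discriminate. cbn. apply H1; [assumption..|]. cbn. congruence.
  - intros (H1 & _) S ops Z bv G ts B d y Ho Hb H Hd Hy.
    destruct B as [|G t ts T B]; cbn in H; codes. destruct y as [y|y]; cbn in Hy; codes;
      try discriminate. cbn. now apply H1.
Qed.

Lemma sound_EVF : Forall sound_clause (nth pEVF program []).
Proof.
  repeat apply Forall_cons; try apply Forall_nil; start.
  - intros _ S ops Z bv G b T d [|y L] Ho Hb HT Hd H; cbn in H; codes. reflexivity.
  - intros (H1 & H2 & _) S ops Z bv G b T d [|y L] Ho Hb HT Hd H; cbn in H; codes.
    unfold etbl. cbn. f_equal. f_equal; [f_equal|].
    + now symmetry.
    + apply H1; [assumption..|]. cbn. congruence.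
    + now apply H2.
Qed.

Lemma sound_OP : Forall sound_clause (nth pOP program []).
Proof.
  repeat apply Forall_cons; try apply Forall_nil; start.
  - intros _ S ops a b o y f [[_ ->]|(H & Ho & _)] Hp Hy Hf; [|discriminate].
    cbn. subst. reflexivity.
  - intros (H1 & H2 & _) S ops a b o y f [[Ho _]|(H & Ho & ->)] Hp Hy Hf; [discriminate|].
    codes. specialize (H1 _ (eq_sym Ho)). subst. rewrite nth_handler in H1. injection H1 as H1.
    (* The template of a handled operation is evaluated with the free operations, so handling does
       not recurse. *)
    apply H2; [now left| |assumption|]; reflexivity.
Qed.

Lemma mem_In A (x : A) l : mem x l -> In x l.
Proof. induction 1; cbn; auto. Qed.

Lemma sound_TEQ : Forall sound_clause (nth pTEQ program []).
Proof.
  repeat apply Forall_cons; try apply Forall_nil; start.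
  - intros _ S E t u _ _ Ht Hu. apply etree_inj. congruence.
  - intros (H & _) S E t u HS HE Ht Hu. apply teq_sym. auto.
  (* The premise [pIST] supplies a tree for the intermediate code; without one the two conditional
     hypotheses would be vacuous. *)
  - intros (H1 & H2 & H3 & _) S E t u HS HE Ht Hu. destruct (H1 S HS) as [w Hw].
    apply teq_trans with w; auto.
  - intros (H1 & _) S E [a b o x k] [a' b' o' x' k'] HS HE Ht Hu. cbn in Ht, Hu. codes.
    subst. apply eq_sym in H. revert x' k' H1 H0.
    refine (@op_transport S a b o a' b' o' (fun a' b' o' => forall x' k', _ -> _ ->
      teq E (Node o x k) (Node o' x' k')) H _).
    intros x' k' H1 Hx. apply esem_inj in Hx as ->. apply teq_cong. intro y.
    refine (H1 S E b k k' (elts b) eq_refl eq_refl eq_refl eq_refl y _). apply elts_complete.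
  - intros (H1 & H2 & H3 & H4 & H5 & _) S E t u HS HE Ht Hu.
    apply H1 in HE. apply pos_nth in HE as ([G Z l r] & m & <- & Hq). unfold enc_eqn in Hq. cbn in Hq. codes.
    destruct (H2 G ltac:(assumption)) as [d Hd]. destruct (H3 S Z HS ltac:(assumption)) as [bv Hb].
    apply teq_trans with (evt (@tree_ops S) bv l d);
      [|apply teq_trans with (evt (@tree_ops S) bv r d)].
    + apply etree_inj. rewrite Ht. apply H4; try assumption. now left.
    + refine (@teq_ax S E (mkEqn l r) (mem_In m) d bv).
    + apply etree_inj. rewrite Hu. symmetry. apply H5; try assumption. now left.
Qed.

Lemma sound_TEQF : Forall sound_clause (nth pTEQF program []).
Proof.
  repeat apply Forall_cons; try apply Forall_nil; start.
  - intros _ S E b f g [|y L] _ _ H _; cbn in H; [easy|discriminate].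
  - intros (H1 & H2 & _) S E b f g [|y L] HS HE H H'; cbn in H, H'; unfold etbl in *; cbn in H, H';
      codes. intros z [<-|Hz]; [auto|]. eapply H2; eauto.
Qed.

Lemma sound_VAL : Forall sound_clause (nth pVAL program []).
Proof.
  repeat apply Forall_cons; try apply Forall_nil; start.
  intros (H1 & H2 & H3 & _) [S E H] HI. unfold enc_instance in HI. cbn [i_sig i_thy i_hdl] in HI. codes.
  specialize (H1 _ ltac:(eassumption)). apply pos_nth in H1 as (q & m & <- & Hq). unfold enc_eqn in Hq. cbn in Hq. codes.
  destruct (H2 (eG q) ltac:(assumption)) as [d <-].
  destruct (H3 S (eZ q) ltac:(assumption) ltac:(assumption)) as [bv <-].
  exists (pos m), q, d, bv. split; [|reflexivity]. cbn. rewrite <- (map_id E) at 1.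
  apply (nth_pos (fun q => q)).
Qed.

Lemma sound_DEC : Forall sound_clause (nth pDEC program []).
Proof.
  repeat apply Forall_cons; try apply Forall_nil; start.
  intros (H1 & H2 & H3 & H4 & _) [S E H] i q d bv HI Hq Hz. unfold enc_instance in HI.
  cbn [i_sig i_thy i_hdl] in *. codes.
  specialize (H1 _ ltac:(eassumption)). subst.
  rewrite nth_error_map, Hq in H1. cbn in H1. injection H1 as H1. unfold enc_eqn in H1. codes.
  apply H4; try reflexivity; symmetry.
  - apply H2; try assumption; try reflexivity. right; now exists H.
  - apply H3; try assumption; try reflexivity. right; now exists H.
Qed.

Lemma program_sound f : der (concat program) f -> meaning f.
Proof.
  apply der_sound.
  exact (Forall_cons _ sound_TY (Forall_cons _ sound_TYS (Forall_cons _ sound_MEM (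
    Forall_cons _ sound_WFV (Forall_cons _ sound_WFT (Forall_cons _ sound_WFB (
    Forall_cons _ sound_WSIG (Forall_cons _ sound_WTHY (Forall_cons _ sound_WHDL (
    Forall_cons _ sound_WF (Forall_cons _ sound_EN (Forall_cons _ sound_ENS (
    Forall_cons _ sound_PROD (Forall_cons _ sound_TAG (Forall_cons _ sound_ISE (
    Forall_cons _ sound_IST (Forall_cons _ sound_ISF (Forall_cons _ sound_ISZ (
    Forall_cons _ sound_EVV (Forall_cons _ sound_LK (Forall_cons _ sound_INJ (
    Forall_cons _ sound_ZLK (Forall_cons _ sound_EVT (Forall_cons _ sound_EVB (
    Forall_cons _ sound_EVF (Forall_cons _ sound_OP (Forall_cons _ sound_TEQ (
    Forall_cons _ sound_TEQF (Forall_cons _ sound_VAL (Forall_cons _ sound_DEC (Forall_nil _))))))))))))))))))))))))))))))).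
Qed.

(** * Completeness of the Horn program *)

Fixpoint hevall (vs : list nat) (t : hterm) : nat :=
  match t with
  | HV i => nth i vs 0
  | HC c => c
  | HS t => S (hevall vs t)
  | HP t u => cpair (hevall vs t) (hevall vs u)
  end.

Definition instl (vs : list nat) (a : atom) : hfact := (fst a, map (hevall vs) (snd a)).

(** Since [upl 0] and [upr 0] are zero, a finite list padded with zeros is a full assignment;
    derivations thus list only the variables that occur in the clause. *)
Lemma heval_list vs t : heval (fold_right cpair 0 vs) t = hevall vs t.
Proof.
  induction t as [i|c|t IH|t IHt u IHu]; cbn [heval hevall]; [|congruence..].
  unfold var. revert i. induction vs as [|v vs IH]; intro i.
  - assert (H : Nat.iter i upr 0 = 0).
    { induction i as [|i IH]; [reflexivity|].
      rewrite Nat.iter_succ, IH. apply upr_0. }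
    cbn [fold_right]. rewrite H, upl_0. now destruct i.
  - destruct i as [|i]; cbn [fold_right nth].
    + apply upl_cpair.
    + rewrite Nat.iter_succ_r, upr_cpair. apply IH.
Qed.

(** The head is matched through an equation rather than by unification, so that [reflexivity] can
    unfold the encoders until both sides are the same expression. *)
Lemma der_rule k vs p args c :
  nth_error (nth p program []) k = Some c -> instl vs (fst c) = (p, args) ->
  all_of (map (fun b => der (concat program) (instl vs b)) (snd c)) ->
  der (concat program) (p, args).
Proof.
  intros Hc <- H.
  assert (Hi : forall a, inst (fold_right cpair 0 vs) a = instl vs a).
  { intros [q ts]. unfold inst, instl. f_equal. apply map_ext, heval_list. }
  rewrite <- Hi. constructor.
  - apply in_concat. exists (nth p program []). split; [|now apply nth_error_In with k].
    apply nth_In. destruct (le_lt_dec (length program) p) as [L|L]; [|exact L].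
    rewrite (nth_overflow program [] L) in Hc. now destruct k.
  - intros b Hb. rewrite Hi. clear - H Hb. revert H Hb. induction (snd c) as [|b' bs IH]; cbn; [easy|].
    intros [H1 H2] [->|Hb]; auto.
Qed.

Notation "'||-' f" := (der (concat program) f) (at level 70).

Ltac rule k vs :=
  eapply (@der_rule k vs); [reflexivity|reflexivity|];
  cbn [map all_of snd fst instl hevall hnode hcons hnil fold_right nth];
  repeat match goal with |- _ /\ _ => split | |- True => exact I end.

Lemma der_TY t : ||- (pTY, [enc_ty t]).
Proof.
  induction t as [|a b IHa IHb|ts IH] using ty_nested_ind.
  - rule 0 (@nil nat).
  - rule 1 [enc_ty a; enc_ty b]; assumption.
  - rule 2 [enc_ctx ts]. induction IH as [|t ts Ht _ IH].
    + rule 0 (@nil nat).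
    + rule 1 [enc_ty t; enc_ctx ts]; assumption.
Qed.

Lemma der_TYS G : ||- (pTYS, [enc_ctx G]).
Proof.
  induction G as [|t G IH].
  - rule 0 (@nil nat).
  - rule 1 [enc_ty t; enc_ctx G]; [apply der_TY|exact IH].
Qed.

Lemma der_MEM l i x : nth_error l i = Some x -> ||- (pMEM, [enc_list l; i; x]).
Proof.
  revert i. induction l as [|y l IH]; intros [|i] H; try discriminate; cbn in H.
  - injection H as ->. rule 0 [x; enc_list l].
  - rule 1 [y; enc_list l; i; x]. now apply IH.
Qed.

Lemma der_MEMp A (f : A -> nat) l x (m : mem x l) : ||- (pMEM, [enc_list (map f l); pos m; f x]).
Proof. apply der_MEM, nth_pos. Qed.

Lemma der_MEMin A (f : A -> nat) l x : In x l -> exists i, ||- (pMEM, [enc_list (map f l); i; f x]).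
Proof.
  intro H. apply (in_map f) in H. apply In_nth_error in H as [i Hi]. exists i. now apply der_MEM.
Qed.

Lemma der_WFV G t (v : val G t) : ||- (pWFV, [enc_ctx G; enc_ty t; enc_val v]).
Proof.
  induction v as [t m| |a b v IHv w IHw|ts t m w IH].
  - rule 0 [enc_ctx G; enc_ty t; pos m]. apply der_MEMp.
  - rule 1 [enc_ctx G].
  - rule 2 [enc_ctx G; enc_ty a; enc_ty b; enc_val v; enc_val w]; assumption.
  - rule 3 [enc_ctx G; enc_ctx ts; enc_ty t; pos m; enc_val w]; [apply der_MEMp|assumption].
Qed.

Scheme tmpl_mut := Induction for tmpl Sort Prop
with branches_mut := Induction for branches Sort Prop.

Lemma der_WFT S Z G (T : tmpl S Z G) : ||- (pWFT, [esig S; enc_ctx Z; enc_ctx G; enc_tmpl T]).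
Proof.
  induction T as [G t m v|G a b v T IH|G ts v B IH|G a b o v T IH|G|G t ts T IHT B IHB]
    using tmpl_mut with (P0 := fun G ts B =>
      ||- (pWFB, [esig S; enc_ctx Z; enc_ctx G; enc_ctx ts; enc_list (enc_brs B)])).
  - rule 0 [esig S; enc_ctx Z; enc_ctx G; enc_ty t; pos m; enc_val v];
      [apply der_MEMp|apply der_WFV].
  - rule 1 [esig S; enc_ctx Z; enc_ctx G; enc_ty a; enc_ty b; enc_val v; enc_tmpl T];
      [apply der_TY..|exact (der_WFV v)|exact IH].
  - rule 2 [esig S; enc_ctx Z; enc_ctx G; enc_ctx ts; enc_val v; enc_list (enc_brs B)];
      [apply der_TYS|exact (der_WFV v)|exact IH].
  - rule 3 [esig S; enc_ctx Z; enc_ctx G; enc_ty a; enc_ty b; pos o; enc_val v; enc_tmpl T];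
      [|apply der_WFV|exact IH].
    exact (der_MEMp (fun p => node 0 [enc_ty (fst p); enc_ty (snd p)]) o).
  - rule 0 [esig S; enc_ctx Z; enc_ctx G].
  - rule 1 [esig S; enc_ctx Z; enc_ctx G; enc_ty t; enc_ctx ts; enc_tmpl T; enc_list (enc_brs B)];
      assumption.
Qed.

Lemma der_WSIG S : ||- (pWSIG, [esig S]).
Proof.
  induction S as [|[a b] S IH].
  - rule 0 (@nil nat).
  - rule 1 [enc_ty a; enc_ty b; esig S]; [apply der_TY..|exact IH].
Qed.

Lemma der_WTHY S (E : theory S) : ||- (pWTHY, [esig S; ethy E]).
Proof.
  induction E as [|[G Z l r] E IH].
  - rule 0 [esig S].
  - rule 1 [esig S; enc_ctx G; enc_ctx Z; enc_tmpl l; enc_tmpl r; ethy E];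
      [apply der_TYS|apply der_TYS|apply der_WFT|apply der_WFT|exact IH].
Qed.

Lemma der_WHDL S S' (H : forall a b, mem (a, b) S' -> tmpl S [b] [a]) :
  ||- (pWHDL, [esig S; esig S'; enc_list (enc_handler_aux H)]).
Proof.
  induction S' as [|[a b] S' IH].
  - rule 0 [esig S].
  - rule 1 [esig S; enc_ty a; enc_ty b; esig S'; enc_tmpl (H a b (Here S'));
      enc_list (enc_handler_aux (fun a' b' m => H a' b' (There (a, b) m)))];
      [apply (der_WFT (H a b (Here S')))|apply IH].
Qed.

Lemma der_WF I : ||- (pWF, [enc_instance I]).
Proof.
  destruct I as [S E H].
  rule 0 [esig S; ethy E; ehdl H]; [apply der_WSIG|apply der_WTHY|apply der_WHDL].
Qed.

Lemma der_TAG x l l' : ||- (pTAG, [x; enc_list l; enc_list l'; enc_list (map (cpair x) l ++ l')]).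
Proof.
  induction l as [|y l IH].
  - rule 0 [x; enc_list l'].
  - rule 1 [x; y; enc_list l; enc_list l'; enc_list (map (cpair x) l ++ l')]. exact IH.
Qed.

Lemma der_PROD l l' :
  ||- (pPROD, [enc_list l; enc_list l';
               enc_list (map (fun p => cpair (fst p) (snd p)) (list_prod l l'))]).
Proof.
  induction l as [|x l IH].
  - rule 0 [enc_list l'].
  - cbn [list_prod]. rewrite map_app, map_map. 
    rule 1 [x; enc_list l; enc_list l'; enc_list (map (cpair x) l' ++
      map (fun p => cpair (fst p) (snd p)) (list_prod l l'));
      enc_list (map (fun p => cpair (fst p) (snd p)) (list_prod l l'))]; [exact IH|apply der_TAG].
Qed.

Lemma der_EN t : ||- (pEN, [enc_ty t; enc_list (map esem (elts t))]).
Proof.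
  induction t as [|a b IHa IHb|ts IH] using ty_nested_ind.
  - rule 0 (@nil nat).
  - rule 1 [enc_ty a; enc_ty b; enc_list (map esem (elts (Prod a b)));
      enc_list (map esem (elts a)); enc_list (map esem (elts b))]; [assumption..|].
    replace (map esem (elts (Prod a b))) with
      (map (fun p => cpair (fst p) (snd p)) (list_prod (map esem (elts a)) (map esem (elts b))));
      [apply der_PROD|].
    cbn. clear. induction (elts a) as [|x l IH]; cbn; [reflexivity|].
    rewrite !map_app, IH. f_equal. now rewrite !map_map.
  - rule 2 [enc_ctx ts; enc_list (map (esum (@esem) ts) (eltsum elts ts))].
    induction IH as [|t ts Ht _ IH].
    + rule 0 (@nil nat).
    + rule 1 [enc_ty t; enc_ctx ts; enc_list (map (esum (@esem) (t :: ts)) (eltsum elts (t :: ts)));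
        enc_list (map esem (elts t)); enc_list (map (esum (@esem) ts) (eltsum elts ts));
        enc_list (map (cpair 1) (map (esum (@esem) ts) (eltsum elts ts)))]; [assumption..| |].
      * rewrite <- (app_nil_r (map (cpair 1) _)). exact (der_TAG 1 _ []).
      * cbn. rewrite map_app, !map_map. rewrite <- (map_map esem (cpair 0)). apply der_TAG.
Qed.

Lemma der_ISE G (e : senv G) : ||- (pISE, [enc_ctx G; esenv e]).
Proof.
  induction G as [|t G IH].
  - rule 0 (@nil nat).
  - destruct e as [x e]. destruct (der_MEMin esem _ _ (elts_complete t x)) as [i Hi].
    rule 1 [enc_ty t; enc_ctx G; esem x; esenv e; enc_list (map esem (elts t)); i];
      [apply der_EN|exact Hi|apply IH].
Qed.

Lemma der_ISF S b (f : sem b -> tree S) L :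
  (forall y, ||- (pIST, [esig S; etree (f y)])) ->
  ||- (pISF, [esig S; enc_list (map esem L); etbl (fun y => etree (f y)) L]).
Proof.
  intro H. induction L as [|y L IH].
  - rule 0 [esig S].
  - rule 1 [esig S; esem y; enc_list (map esem L); etree (f y); etbl (fun y => etree (f y)) L];
      [apply H|exact IH].
Qed.

Lemma der_IST S (t : tree S) : ||- (pIST, [esig S; etree t]).
Proof.
  induction t as [a b o x k IH].
  destruct (der_MEMin esem _ _ (elts_complete a x)) as [i Hi].
  rule 0 [esig S; pos o; esem x; etbl (fun y => etree (k y)) (elts b); enc_ty a; enc_ty b;
    enc_list (map esem (elts a)); i; enc_list (map esem (elts b))];
    [|apply der_EN|exact Hi|apply der_EN|now apply der_ISF].
  exact (der_MEMp (fun p => node 0 [enc_ty (fst p); enc_ty (snd p)]) o).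
Qed.

Lemma der_ISZ S Z (bv : zenv Z (tree S)) : ||- (pISZ, [esig S; enc_ctx Z; ezenv bv]).
Proof.
  induction Z as [|t Z IH].
  - rule 0 [esig S].
  - destruct bv as [f bv].
    rule 1 [esig S; enc_ty t; enc_ctx Z; etbl (fun y => etree (f y)) (elts t); ezenv bv;
      enc_list (map esem (elts t))]; [apply der_EN|apply der_ISF; intro; apply der_IST|apply IH].
Qed.

Lemma der_LK G t (m : mem t G) (e : senv G) : ||- (pLK, [pos m; esenv e; esem (lookup m e)]).
Proof.
  induction m as [l|y l m IH]; destruct e as [x e].
  - rule 0 [esem x; esenv e].
  - rule 1 [pos m; esem x; esenv e; esem (lookup m e)]. apply IH.
Qed.

Lemma der_INJ ts t (m : mem t ts) (x : sem t) :
  ||- (pINJ, [pos m; esem x; esum (@esem) ts (inj m x)]).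
Proof.
  induction m as [l|y l m IH].
  - rule 0 [esem x].
  - rule 1 [pos m; esem x; esum (@esem) l (inj m x)]. exact IH.
Qed.

Lemma der_EVV G t (v : val G t) e : ||- (pEVV, [enc_val v; esenv e; esem (evv v e)]).
Proof.
  induction v as [t m| |a b v IHv w IHw|ts t m w IH].
  - rule 0 [enc_ty t; pos m; esenv e; esem (lookup m e)]. apply der_LK.
  - rule 1 [esenv e].
  - rule 2 [enc_ty a; enc_ty b; enc_val v; enc_val w; esenv e; esem (evv v e); esem (evv w e)];
      assumption.
  - rule 3 [enc_ctx ts; enc_ty t; pos m; enc_val w; esenv e;
      esum (@esem) ts (inj m (evv w e)); esem (evv w e)]; [exact IH|apply der_INJ].
Qed.

Lemma der_ZLK S Z t (m : mem t Z) (bv : zenv Z (tree S)) y :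
  ||- (pZLK, [pos m; ezenv bv; esem y; etree (zlookup m bv y)]).
Proof.
  induction m as [l|t' l m IH]; destruct bv as [f bv].
  - destruct (der_MEMin (fun y => cpair (esem y) (etree (f y))) _ _ (elts_complete t y)) as [i Hi].
    rule 0 [etbl (fun y => etree (f y)) (elts t); ezenv bv; esem y; etree (f y); i]. exact Hi.
  - rule 1 [pos m; etbl (fun y => etree (f y)) (elts t'); ezenv bv; esem y;
      etree (zlookup m bv y)]. apply IH.
Qed.

Lemma der_EVF S Z m (ops : opsT S (tree S)) (bv : zenv Z (tree S)) G b (T : tmpl S Z (b :: G)) e L :
  (forall e, ||- (pEVT, [m; ezenv bv; enc_tmpl T; esenv e; etree (evt ops bv T e)])) ->
  ||- (pEVF, [m; ezenv bv; enc_tmpl T; esenv e; enc_list (map esem L);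
              etbl (fun y => etree (evt ops bv T (y, e))) L]).
Proof.
  intro H. induction L as [|y L IH].
  - rule 0 [m; ezenv bv; enc_tmpl T; esenv e].
  - rule 1 [m; ezenv bv; enc_tmpl T; esenv e; esem y; enc_list (map esem L);
      etree (evt ops bv T (y, e)); etbl (fun y => etree (evt ops bv T (y, e))) L]; [|exact IH].
    apply (H ((y, e) : senv (b :: G))).
Qed.

(** Abstract in the operations because it is applied twice: the [pOP] premise for handled operations
    itself relies on the instance for the free ones. *)
Lemma der_EVT S m (ops : opsT S (tree S)) :
  (forall a b (o : mem (a, b) S) x f,
    ||- (pOP, [m; pos o; esem x; etbl (fun y => etree (f y)) (elts b); etree (ops a b o x f)])) ->
  forall Z (bv : zenv Z (tree S)) G (T : tmpl S Z G) e,
  ||- (pEVT, [m; ezenv bv; enc_tmpl T; esenv e; etree (evt ops bv T e)]).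
Proof.
  intros Hop Z bv G T.
  induction T as [G t p v|G a b v T IH|G ts v B IH|G a b o v T IH|G|G t ts T IHT B IHB]
    using tmpl_mut with (P0 := fun G ts B => forall e x,
      ||- (pEVB, [m; ezenv bv; enc_list (enc_brs B); esenv e; esum (@esem) ts x;
                  etree (evb ops bv B e x)])).
  - intro e. rule 0 [m; ezenv bv; enc_ty t; pos p; enc_val v; esenv e;
      etree (zlookup p bv (evv v e)); esem (evv v e)]; [apply der_EVV|apply der_ZLK].
  - intro e. rule 1 [m; ezenv bv; enc_ty a; enc_ty b; enc_val v; enc_tmpl T; esenv e;
      etree (evt ops bv T (snd (evv v e), (fst (evv v e), e)));
      esem (fst (evv v e)); esem (snd (evv v e))];
      [exact (der_EVV v e)|exact (IH (snd (evv v e), (fst (evv v e), e)))].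
  - intro e. rule 2 [m; ezenv bv; enc_ctx ts; enc_val v; enc_list (enc_brs B); esenv e;
      etree (evb ops bv B e (evv v e)); esum (@esem) ts (evv v e)];
      [exact (der_EVV v e)|apply IH].
  - intro e. rule 3 [m; ezenv bv; enc_ty a; enc_ty b; pos o; enc_val v; enc_tmpl T; esenv e;
      etree (ops a b o (evv v e) (fun y => evt ops bv T (y, e))); esem (evv v e);
      enc_list (map esem (elts b)); etbl (fun y => etree (evt ops bv T (y, e))) (elts b)];
      [apply der_EVV|apply der_EN|now apply der_EVF|apply Hop].
  - intros e [].
  - intros e [x|x].
    + rule 0 [m; ezenv bv; enc_tmpl T; enc_list (enc_brs B); esenv e; esem x;
        etree (evt ops bv T (x, e))]. exact (IHT (x, e)).
    + rule 1 [m; ezenv bv; enc_tmpl T; enc_list (enc_brs B); esenv e; esum (@esem) ts x;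
        etree (evb ops bv B e x)]. apply IHB.
Qed.

Lemma der_EVT_tree S Z (bv : zenv Z (tree S)) G (T : tmpl S Z G) e :
  ||- (pEVT, [0; ezenv bv; enc_tmpl T; esenv e; etree (evt (@tree_ops S) bv T e)]).
Proof.
  apply der_EVT. intros a b o x f.
  rule 0 [pos o; esem x; etbl (fun y => etree (f y)) (elts b)].
Qed.

Lemma der_EVT_handler S (H : handler S) Z (bv : zenv Z (tree S)) G (T : tmpl S Z G) e :
  ||- (pEVT, [Datatypes.S (ehdl H); ezenv bv; enc_tmpl T; esenv e;
              etree (evt (handler_ops H) bv T e)]).
Proof.
  apply der_EVT. intros a b o x f.
  rule 1 [ehdl H; pos o; esem x; etbl (fun y => etree (f y)) (elts b);
    etree (handler_ops H o x f); enc_tmpl (H a b o)].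
  - apply der_MEM, nth_handler.
  - exact (der_EVT_tree ((f, tt) : zenv [b] (tree S)) (H a b o) ((x, tt) : senv [a])).
Qed.

Lemma der_TEQ S (E : theory S) t u : teq E t u -> ||- (pTEQ, [esig S; ethy E; etree t; etree u]).
Proof.
  induction 1 as [t|t u _ IH|t u w _ IH1 _ IH2|a b o x k k' _ IH|q Hq e bv].
  - rule 0 [esig S; ethy E; etree t].
  - rule 1 [esig S; ethy E; etree u; etree t]. exact IH.
  - rule 2 [esig S; ethy E; etree t; etree w; etree u]; [apply der_IST|assumption..].
  - rule 3 [esig S; ethy E; pos o; esem x; etbl (fun y => etree (k y)) (elts b);
      etbl (fun y => etree (k' y)) (elts b)].
    induction (elts b) as [|y L IHL].
    + rule 0 [esig S; ethy E].
    + rule 1 [esig S; ethy E; esem y; etree (k y); etbl (fun y => etree (k y)) L; etree (k' y);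
        etbl (fun y => etree (k' y)) L]; [apply IH|exact IHL].
  - destruct (der_MEMin enc_eqn _ _ Hq) as [i Hi].
    rule 4 [esig S; ethy E; etree (evt (@tree_ops S) bv (lhs q) e);
      etree (evt (@tree_ops S) bv (rhs q) e); i; enc_ctx (eG q); enc_ctx (eZ q); enc_tmpl (lhs q);
      enc_tmpl (rhs q); esenv e; ezenv bv];
      [exact Hi|apply der_ISE|apply der_ISZ|apply der_EVT_tree..].
Qed.

(** * Handler correctness as derivability *)

Lemma correct_der S (E : theory S) (H : handler S) z :
  handler_correct E H -> ||- (pVAL, [enc_instance (mkInstance E H); z]) ->
  ||- (pDEC, [enc_instance (mkInstance E H); z]).
Proof.
  (* Soundness of [pVAL] decodes [z] into an equation, an environment and a valuation, to which
     correctness applies; completeness then encodes the outcome. *)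
  intros Hc Hz. apply program_sound in Hz.
  destruct (Hz (mkInstance E H) eq_refl) as (i & q & e & bv & Hi & ->).
  cbn [i_thy i_sig] in *.
  rule 0 [esig S; ethy E; ehdl H; i; esenv e; ezenv bv; enc_ctx (eG q); enc_ctx (eZ q);
    enc_tmpl (lhs q); enc_tmpl (rhs q); etree (evt (handler_ops H) bv (lhs q) e);
    etree (evt (handler_ops H) bv (rhs q) e)].
  - exact (der_MEM (map enc_eqn E) i (map_nth_error enc_eqn i E Hi)).
  - apply der_EVT_handler.
  - apply der_EVT_handler.
  - apply der_TEQ, Hc. now apply nth_error_In with i.
Qed.

Lemma der_correct S (E : theory S) (H : handler S) :
  (forall z, ||- (pVAL, [enc_instance (mkInstance E H); z]) ->
    ||- (pDEC, [enc_instance (mkInstance E H); z])) ->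
  handler_correct E H.
Proof.
  intros Hz q Hq e bv. apply In_nth_error in Hq as [i Hi].
  assert (Hd : ||- (pDEC, [enc_instance (mkInstance E H); cpair i (cpair (esenv e) (ezenv bv))])).
  { apply Hz.
    rule 0 [esig S; ethy E; ehdl H; i; esenv e; ezenv bv; enc_ctx (eG q); enc_ctx (eZ q);
      enc_tmpl (lhs q); enc_tmpl (rhs q)]; [|apply der_ISE|apply der_ISZ].
    exact (der_MEM (map enc_eqn E) i (map_nth_error enc_eqn i E Hi)). }
  apply program_sound in Hd. exact (Hd (mkInstance E H) i q e bv eq_refl Hi eq_refl).
Qed.

(** The existential may provide another instance with the same code. Injectivity of [enc_instance]
    is bypassed: correctness is equivalent to a statement about the code alone. *)
Lemma HandlerCorrectness_enc S (E : theory S) (H : handler S) :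
  HandlerCorrectness (enc_instance (mkInstance E H)) <-> handler_correct E H.
Proof.
  split.
  - intros ([S' E' H'] & HI & Hc). apply der_correct. rewrite <- HI. intro z.
    now apply correct_der.
  - intro Hc. now exists (mkInstance E H).
Qed.

Lemma HandlerCorrectness_der n :
  HandlerCorrectness n <->
  ||- (pWF, [n]) /\ forall z, ||- (pVAL, [n; z]) -> ||- (pDEC, [n; z]).
Proof.
  split.
  - intros ([S E H] & <- & Hc). split; [apply der_WF|]. intro z. now apply correct_der.
  - intros [Hw Hz]. apply program_sound in Hw as [[S E H] <-].
    now apply HandlerCorrectness_enc, der_correct.
Qed.

Lemma Pi2_HandlerCorrectness : Pi2 HandlerCorrectness.
Proof. exact (@Pi2_der _ _ _ _ _ HandlerCorrectness_der). Qed.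

(** * The equational interpreter *)

(* [LHead], [LTail], [LCall], [LIter] and [LTest] build continuations;
   [LSearch f n l k] passes to [k] the first zero [m >= n] of [f (m, l)]. *)
Inductive lab : Set :=
| LAsk | LChk | LTrue | LSucc | LCons
| LRsucc | LRproj | LRcomp | LRprec | LRmin
| LEval | LEvals | LApp | LAppl
| LHead | LTail | LCall | LIter | LTest | LSearch.

Definition labs : list lab :=
  [LAsk; LChk; LTrue; LSucc; LCons; LRsucc; LRproj; LRcomp; LRprec; LRmin;
   LEval; LEvals; LApp; LAppl; LHead; LTail; LCall; LIter; LTest; LSearch].

Definition lidx (l : lab) : nat :=
  match l with
  | LAsk => 0 | LChk => 1 | LTrue => 2 | LSucc => 3 | LCons => 4
  | LRsucc => 5 | LRproj => 6 | LRcomp => 7 | LRprec => 8 | LRmin => 9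
  | LEval => 10 | LEvals => 11 | LApp => 12 | LAppl => 13
  | LHead => 14 | LTail => 15 | LCall => 16 | LIter => 17 | LTest => 18 | LSearch => 19
  end.

(** Positions above [n] are clamped to [n], which makes the function total and is the origin of
    [Nat.min] in the lemmas about valuations. *)
Fixpoint posmem (n k : nat) : mem One (repeat One (S n)) :=
  match n, k with
  | S n', S k' => There One (posmem n' k')
  | _, _ => Here _
  end.

Fixpoint spos (n : nat) : sum_of sem (repeat One n) -> nat :=
  match n with
  | 0 => fun _ => 0
  | S n' => fun s => match s with inl _ => 0 | inr s' => S (spos n' s') end
  end.

Definition labT : ty := Sum (repeat One 20).
Definition fourT : ty := Sum (repeat One 4).
(** The label is a parameter of a single 4-ary operation, so case analyses on operations have two
    cases and the handler branches by one match. The constant provides the leaves, without which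
    there would be no trees. *)
Definition sg : signature := [(One, Sum []); (labT, fourT)].

Definition labval (l : lab) : sem labT := inj (posmem 19 (lidx l)) tt.
Definition labof (s : sem labT) : lab := nth (spos 20 s) labs LAsk.
Definition arg (i : nat) : sem fourT := inj (posmem 3 i) tt.

Lemma labof_labval l : labof (labval l) = l.
Proof. now destruct l. Qed.

Lemma labval_labof s : labval (labof s) = s.
Proof. cbn in s. repeat (destruct s as [[]|s]; [reflexivity|]). destruct s. Qed.

Definition sel {X : Type} (a b c d : X) (s : sem fourT) : X := nth (spos 4 s) [a; b; c; d] a.

Lemma sel_eta {X : Type} (k : sem fourT -> X) s :
  sel (k (arg 0)) (k (arg 1)) (k (arg 2)) (k (arg 3)) s = k s.
Proof. cbn in s. repeat (destruct s as [[]|s]; [reflexivity|]). destruct s. Qed.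

Definition op0 : mem (One, Sum []) sg := Here _.
Definition op4 : mem (labT, fourT) sg := There _ (Here _).

Lemma sg_case (Q : forall a b, mem (a, b) sg -> Prop) :
  Q _ _ op0 -> Q _ _ op4 -> forall a b o, Q a b o.
Proof.
  intros H1 H2 a b o.
  refine (mem_inv o (fun p => match p with (a, b) => Q a b end) H1 _).
  intros [a' b'] m. refine (mem_inv m (fun p =>
    match p return mem p _ -> Prop with (a, b) => fun m => Q a b (There _ m) end) H2 _).
  intros p' m'. destruct (mem_nil m').
Qed.

Inductive tm : Set :=
| V : nat -> tm
| C0 : tm
| Op : lab -> tm -> tm -> tm -> tm -> tm.

(** Subterms become branches of a match on the bound argument, so each level adds a [fourT] and a
    [One] to the context. The parameter [var] serves both equations, where variables are template
    variables, and handlers, where they are arguments of the continuation. *)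
Fixpoint compile {Z} (var : forall G, nat -> tmpl sg Z G) (G : list ty) (t : tm) : tmpl sg Z G :=
  match t with
  | V i => var G i
  | C0 => TOp op0 (VUnit G) (TCase (VVar (Here G)) (BNil sg Z _))
  | Op l a b c d =>
      TOp op4 (VInj (posmem 19 (lidx l)) (VUnit G)) (TCase (VVar (Here G))
        (BCons (compile var _ a) (BCons (compile var _ b) (BCons (compile var _ c)
          (BCons (compile var _ d) (BNil sg Z _))))))
  end.

Definition c0 : tree sg := Node op0 tt (fun e : sem (Sum []) => match e with end).
Definition op (l : lab) (a b c d : tree sg) : tree sg := Node op4 (labval l) (sel a b c d).

Fixpoint tmv (rho : nat -> tree sg) (t : tm) : tree sg :=
  match t with
  | V i => rho i
  | C0 => c0
  | Op l a b c d => op l (tmv rho a) (tmv rho b) (tmv rho c) (tmv rho d)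
  end.

(** Holds over every theory, even the empty one, since the two trees differ only in the presentation
    of their branching functions. *)
Lemma evt_compile E Z (bv : zenv Z (tree sg)) var rho :
  (forall G e i, evt (@tree_ops sg) bv (var G i) e = rho i) ->
  forall t G e, teq E (evt (@tree_ops sg) bv (compile var G t) e) (tmv rho t).
Proof.
  intros Hv. induction t as [i| |l a IHa b IHb c IHc d IHd]; intros G e.
  - cbn. rewrite Hv. apply teq_refl.
  - apply teq_cong. intros [].
  - apply teq_cong. cbn. intro s. 
    repeat (destruct s as [[]|s]; [cbn; auto|]). destruct s.
Qed.

Lemma teq_op E l a b c d a' b' c' d' :
  teq E a a' -> teq E b b' -> teq E c c' -> teq E d d' -> teq E (op l a b c d) (op l a' b' c' d').
Proof.
  intros. apply teq_cong. cbn. intro s.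
  repeat (destruct s as [[]|s]; [assumption|]). destruct s.
Qed.

Lemma Node_op0 E x k : teq E (Node op0 x k) c0.
Proof. destruct x. apply teq_cong. intros []. Qed.

Lemma Node_op4 E x k :
  teq E (Node op4 x k) (op (labof x) (k (arg 0)) (k (arg 1)) (k (arg 2)) (k (arg 3))).
Proof.
  unfold op. rewrite labval_labof. apply teq_cong. intro y. rewrite sel_eta. apply teq_refl.
Qed.

Notation op1 l a := (Op l a C0 C0 C0).
Notation op2 l a b := (Op l a b C0 C0).
Notation op3 l a b c := (Op l a b c C0).
Notation TT := (op1 LTrue C0).

(* [C0] doubles as the numeral 0, the empty list, the program [RZero] and the
   continuation that accepts every number. *)
Definition eqs : list (tm * tm) :=
  let a := V 0 in let b := V 1 in let f := V 2 in let g := V 3 in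
  let n := V 4 in let x := V 5 in let l := V 6 in let k := V 7 in
  [ (op1 LAsk a, TT);
    (Op LChk C0 x f n, op3 LEval f (op2 LCons n (op2 LCons x C0)) C0);
    (Op LChk (Op LSucc a b g k) x f n, Op LChk a (op1 LSucc x) f n);
    (op3 LEval C0 l k, op2 LApp k C0);
    (op3 LEval (op1 LRsucc C0) (op2 LCons x l) k, op2 LApp k (op1 LSucc x));
    (op3 LEval (op1 LRproj C0) (op2 LCons x l) k, op2 LApp k x);
    (op3 LEval (op1 LRproj (op1 LSucc n)) (op2 LCons x l) k, op3 LEval (op1 LRproj n) l k);
    (op3 LEval (op2 LRcomp f g) l k, op3 LEvals g l (op2 LCall f k));
    (op3 LEvals C0 l k, op2 LAppl k C0);
    (op3 LEvals (op2 LCons f g) l k, op3 LEval f l (op3 LHead g l k));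
    (op2 LApp (op3 LHead g l k) x, op3 LEvals g l (op2 LTail x k));
    (op2 LAppl (op2 LTail x k) l, op2 LAppl k (op2 LCons x l));
    (op2 LAppl (op2 LCall f k) l, op3 LEval f l k);
    (op3 LEval (op2 LRprec f g) (op2 LCons C0 l) k, op3 LEval f l k);
    (op3 LEval (op2 LRprec f g) (op2 LCons (op1 LSucc n) l) k,
       op3 LEval (op2 LRprec f g) (op2 LCons n l) (Op LIter g n l k));
    (op2 LApp (Op LIter g n l k) x, op3 LEval g (op2 LCons n (op2 LCons x l)) k);
    (op3 LEval (op1 LRmin f) l k, Op LSearch f C0 l k);
    (Op LSearch f n l k, op3 LEval f (op2 LCons n l) (Op LTest f n l k));
    (op2 LApp (Op LTest f n l k) C0, op2 LApp k n);
    (op2 LApp (Op LTest f n l k) (op1 LSucc x), Op LSearch f (op1 LSucc n) l k);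
    (op2 LApp C0 x, TT) ]
  ++ map (fun j => (Op LChk (Op j a b g k) x f n, TT))
       [LAsk; LChk; LTrue; LCons; LRsucc; LRproj; LRcomp; LRprec; LRmin;
        LEval; LEvals; LApp; LAppl; LHead; LTail; LCall; LIter; LTest; LSearch].

Definition evar (G : list ty) (i : nat) : tmpl sg (repeat One 8) G :=
  TVar sg (posmem 7 i) (VUnit G).

Definition mkq (p : tm * tm) : eqn sg :=
  @mkEqn sg [] (repeat One 8) (compile evar [] (fst p)) (compile evar [] (snd p)).

Definition thy : theory sg := map mkq eqs.

Fixpoint mkbv {X : Type} (n : nat) (rho : nat -> X) : zenv (repeat One n) X :=
  match n with
  | 0 => tt
  | S n' => (fun _ => rho 0, mkbv n' (fun i => rho (S i)))
  end.

Lemma zlookup_mkbv X n i (rho : nat -> X) :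
  zlookup (posmem n i) (mkbv (S n) rho) tt = rho (Nat.min i n).
Proof.
  revert i rho. induction n as [|n IH]; intros [|i] rho; try reflexivity.
  exact (IH i (fun i => rho (S i))).
Qed.

Lemma ax_teq j vs l r :
  nth_error eqs j = Some (l, r) ->
  let rho := fun i => nth (Nat.min i 7) vs c0 in teq thy (tmv rho l) (tmv rho r).
Proof.
  intros H rho. set (bv := mkbv 8 (fun i => nth i vs c0)).
  assert (Hv : forall G e i, evt (@tree_ops sg) bv (evar G i) e = rho i).
  { intros G e i. apply (zlookup_mkbv 7 i (fun i => nth i vs c0)). }
  eapply teq_trans; [apply teq_sym, (evt_compile thy bv evar rho Hv l [] tt)|].
  eapply teq_trans; [|apply (evt_compile thy bv evar rho Hv r [] tt)].
  apply (@teq_ax sg thy (mkq (l, r))). apply in_map. now apply nth_error_In with j.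
Qed.

Lemma ax_junk j vs : j <> LSucc ->
  let rho := fun i => nth (Nat.min i 7) vs c0 in
  teq thy (tmv rho (Op LChk (Op j (V 0) (V 1) (V 3) (V 7)) (V 5) (V 2) (V 4))) (tmv rho TT).
Proof.
  (* The equations for junk follow the 21 equations of the interpreter, hence the indices 21 to
     39. *)
  intros Hj. destruct j; try congruence;
    [apply (@ax_teq 21)|apply (@ax_teq 22)|apply (@ax_teq 23)|apply (@ax_teq 24)|apply (@ax_teq 25)
    |apply (@ax_teq 26)|apply (@ax_teq 27)|apply (@ax_teq 28)|apply (@ax_teq 29)|apply (@ax_teq 30)
    |apply (@ax_teq 31)|apply (@ax_teq 32)|apply (@ax_teq 33)|apply (@ax_teq 34)|apply (@ax_teq 35)
    |apply (@ax_teq 36)|apply (@ax_teq 37)|apply (@ax_teq 38)|apply (@ax_teq 39)]; reflexivity.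
Qed.

(** * Completeness of the equational interpreter *)

Fixpoint numtm (n : nat) : tm := match n with 0 => C0 | S n' => op1 LSucc (numtm n') end.

Fixpoint prgtm (p : rf) : tm :=
  match p with
  | RZero => C0
  | RSucc => op1 LRsucc C0
  | RProj i => op1 LRproj (numtm i)
  | RComp f gs => op2 LRcomp (prgtm f) (fold_right (fun g t => op2 LCons (prgtm g) t) C0 gs)
  | RPrec f g => op2 LRprec (prgtm f) (prgtm g)
  | RMin f => op1 LRmin (prgtm f)
  end.

Definition lsttm (l : list nat) : tm := fold_right (fun n t => op2 LCons (numtm n) t) C0 l.

Fixpoint closed (t : tm) : Prop :=
  match t with
  | V _ => False
  | C0 => True
  | Op _ a b c d => closed a /\ closed b /\ closed c /\ closed d
  end.

Lemma closed_tmv t rho rho' : closed t -> tmv rho t = tmv rho' t.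
Proof.
  induction t as [i| |l a IHa b IHb c IHc d IHd]; cbn; [easy|reflexivity|].
  intros (Ha & Hb & Hc & Hd). now rewrite IHa, IHb, IHc, IHd.
Qed.

Lemma closed_num n : closed (numtm n).
Proof. induction n; cbn; auto. Qed.

Lemma closed_prg p : closed (prgtm p).
Proof.
  induction p as [| |i|f gs IHf IHgs|f g IHf IHg|f IHf] using rf_nested_ind; cbn;
    repeat split; auto using closed_num.
  induction IHgs; cbn; repeat split; auto.
Qed.

Definition cl (t : tm) : tree sg := tmv (fun _ => c0) t.

Notation assign a b f g n x l k := [a; b; f; g; n; x; l; k].

(** Since [k] is an arbitrary tree, the hypothesis for a subprogram applies directly at the
    continuation that the interpreter pushes ([LHead], [LIter], [LTest]). *)
Lemma eval_complete p xs v k :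
  reval p xs v ->
  teq thy (op LEval (cl (prgtm p)) (cl (lsttm xs)) k c0) (op LApp k (cl (numtm v)) c0 c0).
Proof.
  revert xs v k. induction p as [| |i|f gs IHf IHgs|f g IHf IHg|f IHf] using rf_nested_ind;
    intros xs v k H.
  - inversion H; subst. exact (@ax_teq 3 (assign c0 c0 c0 c0 c0 c0 (cl (lsttm xs)) k) _ _ eq_refl).
  - inversion H as [|x xs'| | | | |]; subst.
    exact (@ax_teq 4 (assign c0 c0 c0 c0 c0 (cl (numtm x)) (cl (lsttm xs')) k) _ _ eq_refl).
  - inversion H as [| |i' xs' Hi| | | |]; subst. clear H. revert i Hi.
    induction xs as [|x xs IH]; intros [|i] Hi; cbn in Hi; try lia.
    + exact (@ax_teq 5 (assign c0 c0 c0 c0 c0 (cl (numtm x)) (cl (lsttm xs)) k) _ _ eq_refl).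
    + eapply teq_trans; [|apply (IH i); lia].
      exact (@ax_teq 6 (assign c0 c0 c0 c0 (cl (numtm i)) (cl (numtm x)) (cl (lsttm xs)) k) _ _ eq_refl).
  - inversion H as [| | |? ? ? ys ? Hys Hv| | |]; subst. clear H.
    eapply teq_trans;
      [exact (@ax_teq 7 (assign c0 c0 (cl (prgtm f))
         (cl (fold_right (fun g t => op2 LCons (prgtm g) t) C0 gs))
         c0 c0 (cl (lsttm xs)) k) _ _ eq_refl)|].
    cbn [tmv nth Nat.min].
    assert (Hgs : forall k, teq thy
      (op LEvals (cl (fold_right (fun g t => op2 LCons (prgtm g) t) C0 gs)) (cl (lsttm xs)) k c0)
      (op LAppl k (cl (lsttm ys)) c0 c0)).
    { clear IHf Hv k. revert ys Hys. induction IHgs as [|g gs IHg _ IH]; intros ys Hys k;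
        inversion Hys as [|? ? ? y ys' Hy Hys']; subst.
      - exact (@ax_teq 8 (assign c0 c0 c0 c0 c0 c0 (cl (lsttm xs)) k) _ _ eq_refl).
      - eapply teq_trans;
          [exact (@ax_teq 9 (assign c0 c0 (cl (prgtm g))
             (cl (fold_right (fun g t => op2 LCons (prgtm g) t) C0 gs))
             c0 c0 (cl (lsttm xs)) k) _ _ eq_refl)|].
        eapply teq_trans; [apply (IHg _ _ _ Hy)|].
        eapply teq_trans;
          [exact (@ax_teq 10 (assign c0 c0 c0
             (cl (fold_right (fun g t => op2 LCons (prgtm g) t) C0 gs))
             c0 (cl (numtm y)) (cl (lsttm xs)) k) _ _ eq_refl)|].
        eapply teq_trans; [apply (IH _ Hys')|].
        exact (@ax_teq 11 (assign c0 c0 c0 c0 c0 (cl (numtm y)) (cl (lsttm ys')) k) _ _ eq_refl). }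
    eapply teq_trans; [apply Hgs|].
    eapply teq_trans; [|apply (IHf _ _ _ Hv)].
    exact (@ax_teq 12 (assign c0 c0 (cl (prgtm f)) c0 c0 c0 (cl (lsttm ys)) k) _ _ eq_refl).
  - destruct xs as [|n xs]; [inversion H|]. revert v k H.
    induction n as [|n IH]; intros v k H; inversion H as [| | | |? ? ? ? Hv|? ? ? ? w ? Hw Hv|]; subst.
    + eapply teq_trans; [|apply (IHf _ _ _ Hv)].
      exact (@ax_teq 13 (assign c0 c0 (cl (prgtm f)) (cl (prgtm g)) c0 c0 (cl (lsttm xs)) k) _ _ eq_refl).
    + eapply teq_trans;
        [exact (@ax_teq 14 (assign c0 c0 (cl (prgtm f)) (cl (prgtm g)) (cl (numtm n)) c0
           (cl (lsttm xs)) k) _ _ eq_refl)|].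
      eapply teq_trans; [apply (IH _ _ Hw)|].
      eapply teq_trans; [|apply (IHg _ _ _ Hv)].
      exact (@ax_teq 15 (assign c0 c0 c0 (cl (prgtm g)) (cl (numtm n)) (cl (numtm w))
        (cl (lsttm xs)) k) _ _ eq_refl).
  - inversion H as [| | | | | |? ? ? H0 Hlt]; subst. clear H.
    eapply teq_trans;
      [exact (@ax_teq 16 (assign c0 c0 (cl (prgtm f)) c0 c0 c0 (cl (lsttm xs)) k) _ _ eq_refl)|].
    (* The search counts upwards, so the induction is on the distance [d] from the current candidate
       to the minimum. *)
    assert (Hs : forall d m, m + d = v ->
      teq thy (op LSearch (cl (prgtm f)) (cl (numtm m)) (cl (lsttm xs)) k)
        (op LApp k (cl (numtm v)) c0 c0)); [|exact (Hs v 0 eq_refl)].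
    induction d as [|d IH]; intros m Hm;
      (eapply teq_trans;
        [exact (@ax_teq 17 (assign c0 c0 (cl (prgtm f)) c0 (cl (numtm m)) c0 (cl (lsttm xs)) k) _ _
                  eq_refl)|]).
    + replace m with v by lia. eapply teq_trans; [apply (IHf _ _ _ H0)|].
      exact (@ax_teq 18 (assign c0 c0 (cl (prgtm f)) c0 (cl (numtm v)) c0 (cl (lsttm xs)) k) _ _ eq_refl).
    + destruct (Hlt m ltac:(lia)) as [j Hj]. eapply teq_trans; [apply (IHf _ _ _ Hj)|].
      eapply teq_trans; [|apply (IH (S m)); lia].
      exact (@ax_teq 19 (assign c0 c0 (cl (prgtm f)) c0 (cl (numtm m)) (cl (numtm j))
        (cl (lsttm xs)) k) _ _ eq_refl).
Qed.

(** Induction on the tree [z] with the accumulator [w] general: a successor moves one unit from [z]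
    to [w], junk gives [LTrue] at once, and at the constant [p] runs on [[n; w]] with the accepting
    continuation. *)
Lemma chk_complete p n :
  (forall x, exists v, reval p [n; x] v) ->
  forall z w, teq thy (op LChk z (cl (numtm w)) (cl (prgtm p)) (cl (numtm n))) (cl TT).
Proof.
  intros H z. induction z as [a b o x k IH]. revert x k IH.
  refine (sg_case (fun a b o => forall x k, _ -> forall w,
    teq thy (op LChk (Node o x k) (cl (numtm w)) (cl (prgtm p)) (cl (numtm n))) (cl TT)) _ _ o);
    intros x k IH w.
  - eapply teq_trans; [apply teq_op; [apply Node_op0|apply teq_refl..]|].
    eapply teq_trans;
      [exact (@ax_teq 1 (assign c0 c0 (cl (prgtm p)) c0 (cl (numtm n)) (cl (numtm w)) c0 c0) _ _
                eq_refl)|].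
    destruct (H w) as [v Hv]. eapply teq_trans; [exact (eval_complete c0 Hv)|].
    exact (@ax_teq 20 (assign c0 c0 c0 c0 c0 (cl (numtm v)) c0 c0) _ _ eq_refl).
  - eapply teq_trans; [apply teq_op; [apply Node_op4|apply teq_refl..]|].
    assert (Hj : labof x = LSucc \/ labof x <> LSucc)
      by (destruct (labof x); try (right; discriminate); now left).
    destruct Hj as [->|Hj].
    + eapply teq_trans; [|apply (IH (arg 0) (S w))].
      exact (@ax_teq 2 (assign (k (arg 0)) (k (arg 1)) (cl (prgtm p)) (k (arg 2)) (cl (numtm n))
        (cl (numtm w)) c0 (k (arg 3))) _ _ eq_refl).
    + exact (ax_junk (assign (k (arg 0)) (k (arg 1)) (cl (prgtm p)) (k (arg 2)) (cl (numtm n))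
        (cl (numtm w)) c0 (k (arg 3))) Hj).
Qed.

(** * The model of computations *)

(* Every element is given a value of each sort the interpreter manipulates, a
   default one where it makes no sense, so that the equations also hold on
   ill-sorted terms. *)
Record model : Type := mkModel {
  num : nat;
  isnum : bool;
  lst : list nat;
  prg : rf;
  prgs : list rf;
  cont : nat -> Prop;
  lcont : list nat -> Prop;
  holds : Prop }.

Definition mzero : model := mkModel 0 true [] RZero [] (fun _ => True) (fun _ => False) False.

Definition mlst l ps := mkModel 0 false l RZero ps (fun _ => False) (fun _ => False) False.
Definition mprg p := mkModel 0 false [] p [] (fun _ => False) (fun _ => False) False.
Definition mcont K := mkModel 0 false [] RZero [] K (fun _ => False) False.
Definition mlcont K := mkModel 0 false [] RZero [] (fun _ => False) K False.
Definition mholds P := mkModel 0 false [] RZero [] (fun _ => False) (fun _ => False) P.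

Definition msearch (f : rf) (n : nat) (xs : list nat) (K : nat -> Prop) : Prop :=
  exists m, n <= m /\ reval f (m :: xs) 0 /\
    (forall j, n <= j < m -> exists v, reval f (j :: xs) (S v)) /\ K m.

Definition mop (l : lab) (a b c d : model) : model :=
  match l with
  | LAsk => mholds True
  (* [isnum] tells whether the chain of successors ends in [C0]; otherwise [LChk] is true, as the
     junk equations demand. The conjunct [True] is the accepting continuation of [mzero], so the
     equation for [LChk C0] holds by computation. *)
  | LChk => mholds (if isnum a
      then exists v, reval (prg c) [num d; num a + num b] v /\ True else True)
  | LTrue => mholds True
  | LSucc => mkModel (S (num a)) (isnum a) [] RZero [] (fun _ => False) (fun _ => False) False
  | LCons => mlst (num a :: lst b) (prg a :: prgs b)
  | LRsucc => mprg RSucc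
  | LRproj => mprg (RProj (num a))
  | LRcomp => mprg (RComp (prg a) (prgs b))
  | LRprec => mprg (RPrec (prg a) (prg b))
  | LRmin => mprg (RMin (prg a))
  | LEval => mholds (exists v, reval (prg a) (lst b) v /\ cont c v)
  | LEvals => mholds (exists vs, revals (prgs a) (lst b) vs /\ lcont c vs)
  | LApp => mholds (cont a (num b))
  | LAppl => mholds (lcont a (lst b))
  | LHead => mcont (fun v => exists vs, revals (prgs a) (lst b) vs /\ lcont c (v :: vs))
  | LTail => mlcont (fun vs => lcont b (num a :: vs))
  | LCall => mlcont (fun vs => exists v, reval (prg a) vs v /\ cont b v)
  | LIter => mcont (fun w => exists v, reval (prg a) (num b :: w :: lst c) v /\ cont d v)
  | LTest => mcont (fun v => match v with
      | 0 => cont d (num b)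
      | S _ => msearch (prg a) (S (num b)) (lst c) (cont d) end)
  | LSearch => mholds (msearch (prg a) (num b) (lst c) (cont d))
  end.

Definition mops : opsT sg model := fun a b o =>
  mem_inv o (fun p _ => match p with (a, b) => sem a -> (sem b -> model) -> model end)
    (fun _ _ => mzero)
    (fun p m => mem_inv m
      (fun p _ => match p with (a, b) => sem a -> (sem b -> model) -> model end)
      (fun x k => mop (labof x) (k (arg 0)) (k (arg 1)) (k (arg 2)) (k (arg 3)))
      (fun p m => match mem_nil m with end)).

Fixpoint interp (t : tree sg) : model :=
  match t with Node o x k => mops o x (fun y => interp (k y)) end.

Fixpoint mval (rho : nat -> model) (t : tm) : model :=
  match t with
  | V i => rho i
  | C0 => mzero
  | Op l a b c d => mop l (mval rho a) (mval rho b) (mval rho c) (mval rho d)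
  end.

Lemma interp_op l a b c d :
  interp (op l a b c d) = mop l (interp a) (interp b) (interp c) (interp d).
Proof.
  change (mop (labof (labval l)) (interp a) (interp b) (interp c) (interp d) =
    mop l (interp a) (interp b) (interp c) (interp d)). now rewrite labof_labval.
Qed.

(** Interpretations are equal in the strict sense although [teq_cong] is pointwise: [mop] inspects a
    branching function at its four arguments only. *)
Lemma interp_teq (E : theory sg) :
  (forall q, In q E -> forall env bv, interp (evt (@tree_ops sg) bv (lhs q) env) =
    interp (evt (@tree_ops sg) bv (rhs q) env)) ->
  forall t u, teq E t u -> interp t = interp u.
Proof.
  intros HE t u. induction 1 as [|t u _ IH|t u w _ IH1 _ IH2|a b o x k k' _ IH|q Hq env bv];
    [reflexivity|now symmetry|congruence| |now apply HE].
  revert x k k' IH. refine (sg_case (fun a b o => forall x k k', _ ->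
    interp (Node o x k) = interp (Node o x k')) _ _ o); intros x k k' IH; [reflexivity|].
  change (mop (labof x) (interp (k (arg 0))) (interp (k (arg 1))) (interp (k (arg 2)))
      (interp (k (arg 3))) =
    mop (labof x) (interp (k' (arg 0))) (interp (k' (arg 1))) (interp (k' (arg 2)))
      (interp (k' (arg 3)))).
  now rewrite !IH.
Qed.

Lemma interp_tmv rho t : interp (tmv rho t) = mval (fun i => interp (rho i)) t.
Proof.
  induction t as [i| |l a IHa b IHb c IHc d IHd]; [reflexivity..|].
  cbn [tmv mval]. now rewrite interp_op, IHa, IHb, IHc, IHd.
Qed.

(** Every equation has a proposition-valued operation at both roots, so propositional extensionality
    suffices and predicates are never compared. *)
Lemma mholds_iff P Q : (P <-> Q) -> mholds P = mholds Q.
Proof. intro H. now rewrite (propositional_extensionality _ _ H). Qed.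

Lemma eqs_valid : Forall (fun p => forall rho, mval rho (fst p) = mval rho (snd p)) eqs.
Proof.
  unfold eqs. cbv zeta. cbn [map app].
  repeat apply Forall_cons; try apply Forall_nil; cbn [fst snd mval mop]; intro rho;
    try reflexivity; apply mholds_iff; cbn [num isnum lst prg prgs cont lcont holds mzero mholds
      mlst mprg mcont mlcont];
    repeat match goal with
    | |- context [num (?r ?i)] => generalize (num (r i)); intro
    | |- context [lst (?r ?i)] => generalize (lst (r i)); intro
    | |- context [prg (?r ?i)] => generalize (prg (r i)); intro
    | |- context [prgs (?r ?i)] => generalize (prgs (r i)); intro
    | |- context [cont (?r ?i)] => generalize (cont (r i)); intro
    | |- context [lcont (?r ?i)] => generalize (lcont (r i)); intro
    end.
  - now rewrite <- plus_n_Sm.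
  - split; [intros (v & H & Hk); now inversion H; subst|intro; eexists; split; [constructor|easy]].
  - split; [intros (v & H & Hk); now inversion H; subst|intro; eexists; split; [constructor|easy]].
  - split; [intros (v & H & Hk); now inversion H; subst|].
    intro; exists n. split; [|easy]. apply (@ev_proj 0 (n :: l)). cbn. lia.
  - split; intros (v & H & Hk); exists v; (split; [|easy]); inversion H as [| |i xs Hi| | | |]; subst.
    + apply (@ev_proj n l). cbn in Hi. lia.
    + apply (@ev_proj (S n) (n0 :: l)). cbn. lia.
  - split.
    + intros (v & H & Hk). inversion H; subst. eauto.
    + intros (vs & Hs & v & H & Hk). exists v. split; [|easy]. econstructor; eassumption.
  - split; [intros (v & H & Hk); now inversion H; subst|intro; eexists; split; [constructor|easy]].
  - split.
    + intros (v & H & Hk). inversion H; subst. eauto.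
    + intros (v & H & vs & Hs & Hk). exists (v :: vs). split; [|easy]. now constructor.
  - split; intros (v & H & Hk); exists v; (split; [|easy]); [now inversion H|now constructor].
  - split.
    + intros (v & H & Hk). inversion H; subst. eauto.
    + intros (w & Hw & v & H & Hk). exists v. split; [|easy]. econstructor; eassumption.
  - split.
    + intros (v & H & Hk). inversion H as [| | | | | |f xs m H0 Hlt]; subst.
      exists v. repeat split; auto with arith. intros j Hj. apply Hlt. lia.
    + intros (m & _ & H & Hlt & Hk). exists m. split; [|easy]. constructor; [assumption|].
      intros j Hj. apply Hlt. lia.
  (* One unfolding of [LSearch]: either the least zero is [n] itself, or [f] takes a successor value
     at [n] and the search resumes at [S n]. *)
  - split.
    + intros (m & Hm & H & Hlt & Hk). destruct (le_lt_eq_dec _ _ Hm) as [L| <-].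
      * destruct (Hlt n) as [v Hv]; [lia|]. exists (S v). split; [assumption|].
        exists m. repeat split; try assumption. intros j Hj. apply Hlt. lia.
      * now exists 0.
    + intros ([|v] & Hv & H).
      * exists n. repeat split; try easy. intros j Hj. lia.
      * destruct H as (m & Hm & H & Hlt & Hk). exists m. repeat split; try easy; [lia|].
        intros j Hj. destruct (Nat.eq_dec j n) as [->|Hn]; [now exists v|]. apply Hlt. lia.
Qed.

Lemma thy_sound t u : teq thy t u -> interp t = interp u.
Proof.
  apply interp_teq. intros q Hq env bv. apply in_map_iff in Hq as ((l, r) & <- & Hp).
  set (rho := fun i => zlookup (posmem 7 i) bv tt).
  assert (Hc : forall t, interp (evt (@tree_ops sg) bv (compile evar [] t) env) =
    mval (fun i => interp (rho i)) t).
  (* A compiled template equals its term already over the empty theory, which every interpretation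
     respects; so the argument is not circular. *)
  { intro t'. rewrite <- interp_tmv. apply (@interp_teq []); [easy|].
    apply (evt_compile [] bv evar rho). reflexivity. }
  cbn [lhs rhs mkq fst snd]. rewrite !Hc.
  pose proof eqs_valid as H. rewrite Forall_forall in H. apply (H _ Hp).
Qed.

Lemma num_numtm n : num (mval (fun _ => mzero) (numtm n)) = n /\ isnum (mval (fun _ => mzero) (numtm n)) = true.
Proof. induction n as [|n [IH1 IH2]]; cbn; auto. Qed.

Lemma prg_prgtm p : prg (mval (fun _ => mzero) (prgtm p)) = p.
Proof.
  induction p as [| |i|f gs IHf IHgs|f g IHf IHg|f IHf] using rf_nested_ind; cbn; try congruence.
  - f_equal. apply num_numtm.
  - f_equal; [assumption|]. induction IHgs as [|g gs Hg _ IH]; cbn; congruence.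
Qed.

Lemma chk_sound p n x :
  teq thy (op LChk (cl (numtm x)) (cl (numtm 0)) (cl (prgtm p)) (cl (numtm n))) (cl TT) ->
  exists v, reval p [n; x] v.
Proof.
  intro H. apply thy_sound in H. unfold cl in H. rewrite interp_op, !interp_tmv in H.
  (* The [holds] components equate [exists v, reval p [n; x] v /\ True] with [True]. *)
  apply (f_equal holds) in H. cbn -[numtm] in H.
  change (fun i : nat => interp c0) with (fun i : nat => mzero) in H.
  rewrite !(proj1 (num_numtm _)), (proj2 (num_numtm _)), prg_prgtm, Nat.add_0_r in H.
  assert (H' : exists v, reval p [n; x] v /\ True) by now rewrite H.
  destruct H' as (v & Hv & _). eauto.
Qed.

(** * The reduction *)

Definition hvar (G : list ty) (i : nat) : tmpl sg [fourT] G :=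
  TVar sg (Here []) (VInj (posmem 3 i) (VUnit G)).

Definition hdl_term (p : rf) (n : nat) (l : lab) : tm :=
  match l with LAsk => Op LChk (V 0) C0 (prgtm p) (numtm n) | _ => TT end.

Fixpoint hbrs (f : lab -> tm) (G : list ty) (ls : list lab) :
  branches sg [fourT] G (repeat One (length ls)) :=
  match ls with
  | [] => BNil sg [fourT] G
  | l :: ls' => BCons (compile hvar _ (f l)) (hbrs f G ls')
  end.

(** The constant is handled by itself. Its template context is not [[fourT]], so [hvar] does not
    fit; as [C0] has no variables, a dummy translation of variables is passed. *)
Definition hdl (p : rf) (n : nat) : handler sg := fun a b o =>
  mem_inv o (fun p _ => match p with (a, b) => tmpl sg [b] [a] end)
    (compile (fun G _ => TOp op0 (VUnit G) (TCase (VVar (Here G)) (BNil sg _ _))) [One] C0)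
    (fun q m => mem_inv m (fun p _ => match p with (a, b) => tmpl sg [b] [a] end)
      (TCase (VVar (Here [])) (hbrs (hdl_term p n) [labT] labs))
      (fun q m => match mem_nil m with end)).

Lemma hdl_op p n x k :
  teq thy (handler_ops (hdl p n) op4 x k) (tmv (fun i => k (arg i)) (hdl_term p n (labof x))).
Proof.
  assert (Hx : handler_ops (hdl p n) op4 x k =
    evb (@tree_ops sg) ((k, tt) : zenv [fourT] (tree sg)) (hbrs (hdl_term p n) [labT] labs)
      ((x, tt) : senv [labT]) x) by reflexivity.
  rewrite Hx. clear Hx. 
  assert (Hb : forall s, evb (@tree_ops sg) ((k, tt) : zenv [fourT] (tree sg))
    (hbrs (hdl_term p n) [labT] labs) ((x, tt) : senv [labT]) s =
    evt (@tree_ops sg) ((k, tt) : zenv [fourT] (tree sg)) (compile hvar [One; labT]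
      (hdl_term p n (labof s))) ((tt, (x, tt)) : senv [One; labT])).
  { cbn [sum_of]. intro s. repeat (destruct s as [[]|s]; [reflexivity|]). destruct s. }
  rewrite Hb. apply evt_compile. reflexivity.
Qed.

Lemma hdl_correct p n :
  handler_correct thy (hdl p n) <-> forall x, exists v, reval p [n; x] v.
Proof.
  assert (Hask : forall rho, tmv rho (hdl_term p n LAsk) =
    op LChk (rho 0) (cl (numtm 0)) (cl (prgtm p)) (cl (numtm n))).
  { intro rho. cbn. rewrite (closed_tmv (prgtm p) rho (fun _ => c0)) by apply closed_prg.
    rewrite (closed_tmv (numtm n) rho (fun _ => c0)) by apply closed_num. reflexivity. }
  assert (Hother : forall l a b c d bv e, l <> LAsk ->
    teq thy (evt (handler_ops (hdl p n)) bv (compile evar [] (Op l a b c d)) e) (cl TT)).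
  { intros l a b c d bv e Hl. refine (teq_trans (hdl_op p n (labval l) _) _).
    rewrite labof_labval. destruct l; try easy; apply teq_refl. }
  assert (Hchk : forall bv e,
    teq thy (evt (handler_ops (hdl p n)) bv (compile evar [] (op1 LAsk (V 0))) e)
      (op LChk (zlookup (posmem 7 0) bv tt) (cl (numtm 0)) (cl (prgtm p)) (cl (numtm n)))).
  { intros bv e. refine (teq_trans (hdl_op p n (labval LAsk) _) _).
    rewrite labof_labval, Hask. apply teq_refl. }
  (* This shape of the equations makes the handler trivial on all but the first: a root other than
     [LAsk] is handled to [LTrue] whatever lies below it. *)
  assert (Heqs : Forall (fun q => q = (op1 LAsk (V 0), TT) \/
    exists l a b c d l' a' b' c' d', q = (Op l a b c d, Op l' a' b' c' d') /\ l <> LAsk /\ l' <> LAsk)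
    eqs).
  { unfold eqs. cbv zeta. cbn [map app]. constructor; [now left|].
    repeat apply Forall_cons; try apply Forall_nil; right; do 10 eexists;
      (split; [reflexivity|split; discriminate]). }
  split.
  (* Numerals are enough to extract halting; the converse has to cover every tree, which is the
     content of [chk_complete]. *)
  - intros H x. apply (@chk_sound p n x).
    specialize (H (mkq (op1 LAsk (V 0), TT)) (or_introl eq_refl) (tt : senv [])
      (mkbv 8 (fun _ => cl (numtm x)))).
    refine (teq_trans (teq_sym (Hchk (mkbv 8 (fun _ => cl (numtm x))) (tt : senv []))) _).
    refine (teq_trans H _). now apply Hother.
  - intros H q Hq e bv. apply in_map_iff in Hq as (lr & <- & Hlr).
    rewrite Forall_forall in Heqs.
    destruct (Heqs _ Hlr) as [-> | (l & a & b & c & d & l' & a' & b' & c' & d' & -> & Hl & Hl')];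
      cbn [lhs rhs mkq fst snd eG eZ] in *.
    + refine (teq_trans (Hchk bv e) _). refine (teq_trans (chk_complete H _ 0) _).
      apply teq_sym. now apply Hother.
    + refine (teq_trans (Hother l a b c d bv e Hl) _). apply teq_sym. now apply Hother.
Qed.

(** * Computability of the reduction *)

Fixpoint etm (t : tm) : nat :=
  match t with
  | V i => enc_tmpl (hvar [] i)
  | C0 => enc_tmpl (compile hvar [] C0)
  | Op l a b c d =>
      node 3 [enc_ty labT; enc_ty fourT; 1; enc_val (VInj (posmem 19 (lidx l)) (VUnit []));
        node 2 [enc_ctx (repeat One 4); enc_val (VVar (Here (x := fourT) []));
          enc_list [etm a; etm b; etm c; etm d]]]
  end.

(** Codes do not record the value context, and compiled terms refer only to its innermost variable,
    so the code is the same at every depth. *)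
Lemma enc_compile G t : enc_tmpl (compile hvar G t) = etm t.
Proof.
  revert G. induction t as [i| |l a IHa b IHb c IHc d IHd]; intro G; [reflexivity..|].
  change (node 3 [enc_ty labT; enc_ty fourT; 1; enc_val (VInj (posmem 19 (lidx l)) (VUnit G));
    node 2 [enc_ctx (repeat One 4); enc_val (VVar (Here (x := fourT) G));
      enc_list [enc_tmpl (compile hvar (One :: fourT :: G) a);
                enc_tmpl (compile hvar (One :: fourT :: G) b);
                enc_tmpl (compile hvar (One :: fourT :: G) c);
                enc_tmpl (compile hvar (One :: fourT :: G) d)]]] = etm (Op l a b c d)).
  rewrite IHa, IHb, IHc, IHd. reflexivity.
Qed.

Ltac cf_codes :=
  repeat match goal with
  | |- cf ?k (fun _ => ?c) => exact (cf_const k c)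
  | |- cf _ (fun _ => S _) => apply cf_succ
  | |- cf _ (fun _ => cpair _ _) => apply cf_cpair
  end; try assumption.

Lemma cf_etm k l A B C D :
  cf k (fun xs => etm (A xs)) -> cf k (fun xs => etm (B xs)) ->
  cf k (fun xs => etm (C xs)) -> cf k (fun xs => etm (D xs)) ->
  cf k (fun xs => etm (Op l (A xs) (B xs) (C xs) (D xs))).
Proof.
  intros HA HB HC HD. cbn [etm]. unfold node at 1 2. cbn [enc_list fold_right].
  cf_codes.
Qed.

(** The numeral for the input is the only varying part of the reduction; its code is an iteration of
    one encoding step. *)
Lemma cf_num k N : cf k N -> cf k (fun xs => etm (numtm (N xs))).
Proof.
  intro HN.
  set (c := etm C0).
  set (next := fun w => node 3 [enc_ty labT; enc_ty fourT; 1;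
    enc_val (VInj (posmem 19 (lidx LSucc)) (VUnit []));
    node 2 [enc_ctx (repeat One 4); enc_val (VVar (Here (x := fourT) [])); enc_list [w; c; c; c]]]).
  apply (@cf_ext k (fun xs => Nat.iter (N xs) next c)).
  - intros xs _. induction (N xs) as [|n IH]; [reflexivity|].
    rewrite Nat.iter_succ, IH. reflexivity.
  - apply cf_iter; [|assumption|apply cf_const].
    assert (H0 := cf_proj (k := 1) (i := 0) ltac:(lia)).
    unfold next. unfold node at 1 2. cbn [enc_list fold_right].
    cf_codes.
Qed.

Lemma enc_hbrs f G ls : enc_brs (hbrs f G ls) = map (fun l => etm (f l)) ls.
Proof. induction ls as [|l ls IH]; [reflexivity|]. cbn. now rewrite enc_compile, IH. Qed.

Definition reduction (p : rf) (n : nat) : nat := enc_instance (mkInstance thy (hdl p n)).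

Lemma reduction_eq p n :
  reduction p n = node 0 [esig sg; ethy thy; enc_list [enc_tmpl (hdl p n op0);
    node 2 [enc_ctx (repeat One 20); enc_val (VVar (Here (x := labT) []));
      enc_list (map (fun l => etm (hdl_term p n l)) labs)]]].
Proof. rewrite <- (enc_hbrs _ [labT]). reflexivity. Qed.

Lemma reduction_computable p : computable (reduction p).
Proof.
  enough (H : cf 1 (fun xs => reduction p (nth 0 xs 0))).
  { destruct H as [r Hr]. exists r. intro n. now apply (Hr [n]). }
  eapply cf_ext; [intros xs _; symmetry; apply reduction_eq|].
  assert (HA := @cf_etm 1 LChk (fun _ => V 0) (fun _ => C0) (fun _ => prgtm p)
    (fun xs => numtm (nth 0 xs 0)) (cf_const 1 (etm (V 0))) (cf_const 1 (etm C0))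
    (cf_const 1 (etm (prgtm p))) (cf_num (cf_proj (k := 1) (i := 0) ltac:(lia)))).
  cbv beta in HA.
  change (cf 1 (fun xs => node 0 [esig sg; ethy thy; enc_list [etm C0;
    node 2 [enc_ctx (repeat One 20); enc_val (VVar (Here (x := labT) []));
      enc_list (map (fun l => etm (hdl_term p (nth 0 xs 0) l)) labs)]]])).
  unfold node. cbn [labs map hdl_term enc_list fold_right]. cf_codes.
Qed.

(** Turns the inner existential into halting. [RMin] passes the searched value first, and the
    projections rearrange [[y; n; x]] into [[n; x; y]]. *)
Lemma exists_min p n x :
  (forall y, exists v, reval p [n; x; y] v) ->
  (exists y, reval p [n; x; y] 0) <->
  exists v, reval (RMin (RComp p [RProj 1; RProj 2; RProj 0])) [n; x] v.
Proof.
  intro Hp.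
  assert (Hs : forall y v, reval (RComp p [RProj 1; RProj 2; RProj 0]) [y; n; x] v <->
    reval p [n; x; y] v).
  { intros y v. split; intro H.
    - inversion H as [| | |? ? ? ys ? Hys Hv| | |]; subst.
      repeat match goal with
      | H : revals _ _ _ |- _ => inversion H; clear H; subst
      | H : reval (RProj _) _ _ |- _ => inversion H; clear H; subst
      end. exact Hv.
    - econstructor; [|exact H].
      repeat apply evs_cons; [apply (@ev_proj 1 [y; n; x])|apply (@ev_proj 2 [y; n; x])
        |apply (@ev_proj 0 [y; n; x])|apply evs_nil]; cbn; lia. }
  split.
  - intros [y Hy].
    (* A known zero [y] bounds the search, and totality of [p] decides each candidate [m] on the way
       up; the invariant is that all values below [m] are successors. *)
    assert (Hl : forall d m, m + d = y -> (forall j, j < m -> exists v, reval p [n; x; j] (S v)) ->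
      exists v, reval (RMin (RComp p [RProj 1; RProj 2; RProj 0])) [n; x] v).
    { induction d as [|d IH]; intros m Hm Hlt.
      - exists m. constructor.
        + apply Hs. now replace m with y by lia.
        + intros j Hj. destruct (Hlt j Hj) as [v Hv]. exists v. now apply Hs.
      - destruct (Hp m) as [[|v] Hv].
        + exists m. constructor; [now apply Hs|].
          intros j Hj. destruct (Hlt j Hj) as [v Hv']. exists v. now apply Hs.
        + apply (IH (S m)); [lia|]. intros j Hj. destruct (Nat.eq_dec j m) as [->|Hn]; [eauto|].
          apply Hlt. lia. }
    apply (Hl y 0); [reflexivity|lia].
  - intros [v Hv]. inversion Hv; subst. exists v. now apply Hs.
Qed.

Theorem theorem6p2 : Pi2_complete HandlerCorrectness.
Proof.
  split; [exact Pi2_HandlerCorrectness|].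
  intros B (p & Hp & HB). set (q := RMin (RComp p [RProj 1; RProj 2; RProj 0])).
  exists (reduction q). split; [apply reduction_computable|].
  intro n. unfold reduction. rewrite HandlerCorrectness_enc, hdl_correct, HB.
  split; intros H x; apply exists_min; auto.
Qed.
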